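(* Assume that $\mathfrak c=2^{\aleph_0}$ is a regular cardinal, and let $\mathfrak B$ be the Boolean algebra, unique up to isomorphism, such that $|\mathfrak B|=\mathfrak c$, $\mathfrak B$ is tightly $\sigma$-filtered, and for all embeddings of Boolean algebras $u:A\to\mathfrak B$ and $v:A\to B$ with $|A|<\mathfrak c$ and $v$ posex there exists an embedding $\tilde u:B\to\mathfrak B$ with $\tilde u v=u$. If $\mathfrak B$ is (isomorphic to) $\mathcal P(\omega)/\mathrm{fin}$, then $\mathfrak c\le\aleph_2$.
   Context: $\mathcal P(\omega)/\mathrm{fin}$ is the quotient of the power set algebra of $\omega$ by the ideal of finite sets. Embeddings of Boolean algebras are one-to-one Boolean homomorphisms. For $H\subset B$, $\langle H\rangle$ is the subalgebra generated by $H$. Push-out: let $S,A$ be subalgebras of a Boolean algebra $B$. $B$ is the internal push-out of $S$ and $A$, written $B=\mathbf{PO}[S,A]$, if (i) $B=\langle S\cup A\rangle$, and (ii) for every $a\in A$ and $s\in S$ with $a\le s$ there exists $r\in A\cap S$ with $a\le r\le s$. Posex: if $A$ is a subalgebra of $B$, $B$ is a posex of $A$ if there is a countable subalgebra $S\subset B$ with $B=\mathbf{PO}[S,A]$. An embedding $v:A\to B$ is posex if $B$ is a posex of $v(A)$. A Boolean algebra $\mathfrak B$ is tightly $\sigma$-filtered if there exist an ordinal $\lambda$ and subalgebras $\{B_\alpha:\alpha\le\lambda\}$ of $\mathfrak B$ such that $B_\alpha\subset B_\beta$ for $\alpha<\beta\le\lambda$; $B_0=\{0,1\}$ and $B_\lambda=\mathfrak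 B$; $B_{\alpha+1}$ is a posex of $B_\alpha$ for every $\alpha<\lambda$; and $B_\beta=\bigcup_{\alpha<\beta}B_\alpha$ for every limit ordinal $\beta\le\lambda$. The existence and uniqueness up to isomorphism of $\mathfrak B$ (for $\mathfrak c$ regular) is a theorem of the same paper. *)

(* Defs.v *)
From HB Require Import structures.
From mathcomp Require Import all_boot all_order.
From mathcomp Require Import boolp wochoice classical_sets functions cardinality.

Set Implicit Arguments.
Unset Strict Implicit.
Unset Printing Implicit Defensive.

Import Order.TTheory.
Local Open Scope classical_set_scope.
Local Open Scope card_scope.
Local Open Scope quotient_scope.

Definition card_lt (T U : Type) (A : set T) (B : set U) : bool :=
  (A #<= B) && (A #!= B).

(* A well-ordered type whose order type is an initial ordinal. *)
Definition initial_ordinal (d : Order.disp_t) (W : orderType d) : Prop :=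
  well_order (<=%O : rel W) /\
  forall x : W, card_lt [set y : W | (y < x)%O] [set: W].

Definition cofinal (d : Order.disp_t) (W : orderType d) (C : set W) : Prop :=
  forall x : W, exists2 y, C y & (x <= y)%O.

(* |K| is infinite and equal to its own cofinality: every cofinal subset of the
   initial ordinal of cardinality |K| has cardinality |K|. *)
Definition regular_cardinal (K : Type) : Prop :=
  infinite_set [set: K] /\
  forall (d : Order.disp_t) (W : orderType d),
    initial_ordinal W -> [set: W] #= [set: K] ->
    forall C : set W, cofinal C -> C #= [set: K].

Definition card_successor (K K' : Type) : Prop :=
  card_lt [set: K] [set: K'] /\
  forall X : Type, card_lt [set: K] [set: X] -> [set: K'] #<= [set: X].

Fixpoint is_aleph (n : nat) (K : Type) : Prop :=
  if n is m.+1 then exists2 K', is_aleph m K' & card_successor K' K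
  else [set: K] #= [set: nat].

(* Boolean algebras are complemented distributive lattices with top and bottom;
   the degenerate algebra, in which \bot = \top, is not excluded by the type. *)

Definition subalgebra (d : Order.disp_t) (B : ctbDistrLatticeType d)
    (S : set B) : Prop :=
  [/\ S \bot%O, S \top%O,
      forall x y, S x -> S y -> S (x `&` y)%O,
      forall x y, S x -> S y -> S (x `|` y)%O &
      forall x, S x -> S (~` x)%O].

Definition generated (d : Order.disp_t) (B : ctbDistrLatticeType d)
    (H : set B) : set B :=
  smallest (@subalgebra d B) H.

Definition boolean_morphism (d d' : Order.disp_t) (A : ctbDistrLatticeType d)
    (B : ctbDistrLatticeType d') (f : A -> B) : Prop :=
  [/\ f \bot%O = \bot%O, f \top%O = \top%O,
      forall x y, f (x `&` y)%O = (f x `&` f y)%O,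
      forall x y, f (x `|` y)%O = (f x `|` f y)%O &
      forall x, f (~` x)%O = (~` f x)%O].

Definition boolean_embedding (d d' : Order.disp_t) (A : ctbDistrLatticeType d)
    (B : ctbDistrLatticeType d') (f : A -> B) : Prop :=
  boolean_morphism f /\ injective f.

Definition boolean_isomorphic (d d' : Order.disp_t) (A : ctbDistrLatticeType d)
    (B : ctbDistrLatticeType d') : Prop :=
  exists f : A -> B, boolean_morphism f /\ bijective f.

(* C = PO[S, A], for subalgebras C, S, A of a common Boolean algebra B; the
   first three conditions force C to be a subalgebra containing S and A. *)
Definition pushout (d : Order.disp_t) (B : ctbDistrLatticeType d)
    (C S A : set B) : Prop :=
  [/\ subalgebra S, subalgebra A, C = generated (S `|` A) &
      forall a s, A a -> S s -> (a <= s)%O ->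
        exists r, [/\ (A `&` S) r, (a <= r)%O & (r <= s)%O]].

Definition posex (d : Order.disp_t) (B : ctbDistrLatticeType d)
    (C A : set B) : Prop :=
  exists S : set B, countable S /\ pushout C S A.

Definition posex_embedding (d d' : Order.disp_t) (A : ctbDistrLatticeType d)
    (B : ctbDistrLatticeType d') (v : A -> B) : Prop :=
  boolean_embedding v /\ posex [set: B] (range v).

Definition is_succ (d : Order.disp_t) (L : porderType d) (a b : L) : Prop :=
  (a < b)%O /\ forall c : L, ~ ((a < c)%O /\ (c < b)%O).

Definition is_limit (d : Order.disp_t) (L : bPOrderType d) (b : L) : Prop :=
  b <> \bot%O /\ forall a : L, ~ is_succ a b.

(* The index set {alpha | alpha <= lambda} of the filtration, for an ordinal
   lambda, is a well-order L with a greatest element: its bottom is 0 and its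
   top is lambda. *)
Definition tightly_sigma_filtered (d : Order.disp_t)
    (B : ctbDistrLatticeType d) : Prop :=
  exists (dL : Order.disp_t) (L : tbOrderType dL) (F : L -> set B),
    well_order (<=%O : rel L) /\
    (forall a, subalgebra (F a)) /\
    (forall a b, (a < b)%O -> F a `<=` F b) /\
    F \bot%O = [set \bot%O; \top%O] /\
    F \top%O = [set: B] /\
    (forall a b, is_succ a b -> posex (F b) (F a)) /\
    (forall b, is_limit b -> F b = \bigcup_(a in [set a | (a < b)%O]) F a).

Definition eqfin (X Y : set nat) : bool := `[< finite_set (X `+` Y) >].

Lemma eqfinP (X Y : set nat) :
  eqfin X Y <-> finite_set (X `\` Y) /\ finite_set (Y `\` X).
Proof. by rewrite /eqfin asboolE /setY finite_setU. Qed.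

Lemma eqfin_refl : reflexive eqfin.
Proof. by move=> X; apply/eqfinP; rewrite setDv. Qed.

Lemma eqfin_sym : symmetric eqfin.
Proof. by move=> X Y; rewrite /eqfin setYC. Qed.

Lemma eqfin_trans : transitive eqfin.
Proof.
move=> Y X Z /eqfinP[XY YX] /eqfinP[YZ ZY]; apply/eqfinP; split.
- apply: (@sub_finite_set _ _ ((X `\` Y) `|` (Y `\` Z))).
    by move=> n [Xn Zn]; have [Yn|Yn] := pselect (Y n); [right|left].
  by rewrite finite_setU.
- apply: (@sub_finite_set _ _ ((Z `\` Y) `|` (Y `\` X))).
    by move=> n [Xn Zn]; have [Yn|Yn] := pselect (Y n); [right|left].
  by rewrite finite_setU.
Qed.

Canonical eqfin_equiv := EquivRel eqfin eqfin_refl eqfin_sym eqfin_trans.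

Definition Pomega_fin := {eq_quot eqfin}.
HB.instance Definition _ := Choice.on Pomega_fin.
HB.instance Definition _ := EqQuotient.on Pomega_fin.

Lemma pf_ind (P : Pomega_fin -> Prop) :
  (forall X, P (\pi_Pomega_fin X)) -> forall x, P x.
Proof. by move=> PX x; rewrite -[x]reprK. Qed.

Lemma pifinP (X Y : set nat) :
  \pi_Pomega_fin X = \pi_Pomega_fin Y <-> eqfin X Y.
Proof. by split=> /eqmodP. Qed.

Lemma repr_eqfin (X : set nat) : eqfin (repr (\pi_Pomega_fin X)) X.
Proof. by apply/pifinP; rewrite reprK. Qed.

Definition pf_meet (x y : Pomega_fin) : Pomega_fin :=
  \pi_Pomega_fin (repr x `&` repr y).
Definition pf_join (x y : Pomega_fin) : Pomega_fin :=
  \pi_Pomega_fin (repr x `|` repr y).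
Definition pf_compl (x : Pomega_fin) : Pomega_fin :=
  \pi_Pomega_fin (~` repr x).

Lemma eqfin_setC (X Y : set nat) : eqfin X Y -> eqfin (~` X) (~` Y).
Proof.
move=> /eqfinP[XY YX]; apply/eqfinP.
by rewrite !setDE !setCK ![~` _ `&` _]setIC -!setDE.
Qed.

Lemma eqfin_setI (X X' Y Y' : set nat) :
  eqfin X X' -> eqfin Y Y' -> eqfin (X `&` Y) (X' `&` Y').
Proof.
have half (U U' V V' : set nat) : finite_set (U `\` U') ->
    finite_set (V `\` V') -> finite_set ((U `&` V) `\` (U' `&` V')).
  move=> fU fV; apply: (@sub_finite_set _ _ ((U `\` U') `|` (V `\` V'))).
    move=> n [[Un Vn]] /not_andP[U'n|V'n]; [by left|by right].
  by rewrite finite_setU.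
by move=> /eqfinP[? ?] /eqfinP[? ?]; apply/eqfinP; split; apply: half.
Qed.

Lemma eqfin_setU (X X' Y Y' : set nat) :
  eqfin X X' -> eqfin Y Y' -> eqfin (X `|` Y) (X' `|` Y').
Proof.
move=> eX eY; rewrite -[X `|` Y]setCK -[X' `|` Y']setCK !setCU.
by apply: eqfin_setC; apply: eqfin_setI; apply: eqfin_setC.
Qed.

Lemma pf_meetE (X Y : set nat) :
  pf_meet (\pi_Pomega_fin X) (\pi_Pomega_fin Y) = \pi_Pomega_fin (X `&` Y).
Proof. by apply/pifinP; apply: eqfin_setI; apply: repr_eqfin. Qed.

Lemma pf_joinE (X Y : set nat) :
  pf_join (\pi_Pomega_fin X) (\pi_Pomega_fin Y) = \pi_Pomega_fin (X `|` Y).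
Proof. by apply/pifinP; apply: eqfin_setU; apply: repr_eqfin. Qed.

Lemma pf_complE (X : set nat) :
  pf_compl (\pi_Pomega_fin X) = \pi_Pomega_fin (~` X).
Proof. by apply/pifinP; apply: eqfin_setC; apply: repr_eqfin. Qed.

Definition pf_le (x y : Pomega_fin) : bool := pf_meet x y == x.
Definition pf_lt (x y : Pomega_fin) : bool := (y != x) && pf_le x y.

Lemma pf_meetC : commutative pf_meet.
Proof. by elim/pf_ind=> X; elim/pf_ind=> Y; rewrite !pf_meetE setIC. Qed.
Lemma pf_joinC : commutative pf_join.
Proof. by elim/pf_ind=> X; elim/pf_ind=> Y; rewrite !pf_joinE setUC. Qed.
Lemma pf_meetA : associative pf_meet.
Proof.
by elim/pf_ind=> X; elim/pf_ind=> Y; elim/pf_ind=> Z; rewrite !pf_meetE setIA.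
Qed.
Lemma pf_joinA : associative pf_join.
Proof.
by elim/pf_ind=> X; elim/pf_ind=> Y; elim/pf_ind=> Z; rewrite !pf_joinE setUA.
Qed.
Lemma pf_joinKI (y x : Pomega_fin) : pf_meet x (pf_join x y) = x.
Proof.
elim/pf_ind: y => Y; elim/pf_ind: x => X.
by rewrite pf_joinE pf_meetE setUC setKU.
Qed.
Lemma pf_meetKU (y x : Pomega_fin) : pf_join x (pf_meet x y) = x.
Proof.
elim/pf_ind: y => Y; elim/pf_ind: x => X.
by rewrite pf_meetE pf_joinE setIC setKI.
Qed.
Lemma pf_meetUl : left_distributive pf_meet pf_join.
Proof.
elim/pf_ind=> X; elim/pf_ind=> Y; elim/pf_ind=> Z.
by rewrite !(pf_joinE, pf_meetE) setIUl.
Qed.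
Lemma pf_meetxx : idempotent_op pf_meet.
Proof. by elim/pf_ind=> X; rewrite pf_meetE setIid. Qed.

Fact pf_display : Order.disp_t. Proof. exact: Order.Disp tt tt. Qed.

HB.instance Definition _ :=
  Order.isMeetJoinDistrLattice.Build pf_display Pomega_fin
    (fun _ _ => erefl : pf_le _ _ = _) (fun _ _ => erefl : pf_lt _ _ = _)
    pf_meetC pf_joinC pf_meetA pf_joinA pf_joinKI pf_meetKU pf_meetUl pf_meetxx.

Lemma pf_le0x (x : Pomega_fin) : (\pi_Pomega_fin set0 <= x)%O.
Proof.
elim/pf_ind: x => X; apply/eqP; rewrite -[LHS]/(pf_meet _ _).
by rewrite pf_meetE set0I.
Qed.

Lemma pf_lex1 (x : Pomega_fin) : (x <= \pi_Pomega_fin setT)%O.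
Proof.
elim/pf_ind: x => X; apply/eqP; rewrite -[LHS]/(pf_meet _ _).
by rewrite pf_meetE setIT.
Qed.

HB.instance Definition _ :=
  Order.hasBottom.Build pf_display Pomega_fin pf_le0x.
HB.instance Definition _ :=
  Order.hasTop.Build pf_display Pomega_fin pf_lex1.

Lemma pf_joinxC (x : Pomega_fin) : (x `|` pf_compl x)%O = \top%O.
Proof.
elim/pf_ind: x => X; rewrite -[LHS]/(pf_join _ _) pf_complE pf_joinE.
by rewrite setUCr.
Qed.

Lemma pf_meetxC (x : Pomega_fin) : (x `&` pf_compl x)%O = \bot%O.
Proof.
elim/pf_ind: x => X; rewrite -[LHS]/(pf_meet _ _) pf_complE pf_meetE.
by rewrite setICr.
Qed.

HB.instance Definition _ :=
  Order.TBDistrLattice_hasComplement.Build pf_display Pomega_fin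
    pf_joinxC pf_meetxC.

Lemma le_pifin (X Y : set nat) :
  (\pi_Pomega_fin X <= \pi_Pomega_fin Y)%O <-> finite_set (X `\` Y).
Proof.
rewrite leEmeet -[(_ `&` _)%O]/(pf_meet _ _) pf_meetE.
rewrite -(rwP eqP) pifinP eqfinP setDIr setDv set0U.
by split=> [[]//|fXY]; split=> //; rewrite setDE setIAC setICr set0I.
Qed.

(* Main.v *)
(* Suppose that the continuum exceeds aleph_2. A tight sigma-filtration of BB
   attaches to every closed set H of indices a subalgebra span H, in such a way
   that each element lies in the span of a countable closed set and any a <= b
   with a in span H, b in span K has an interpolant in span (H & K).
   For x : omega -> omega let [x = n], [x < y] be the classes in
   P(omega)/fin of {k | x k = n}, {k | x k < y k}, and call x generic over A
   when every [x = n] meets every nonzero element of A. The extension property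
   yields generic functions over small subalgebras, so one can build a sequence
   of length omega_2 of functions, each generic over the supports of its
   predecessors, and one last function z generic over the supports of all the
   comparisons of two of them. Counting supports as in the free set theorem
   gives x, y in the sequence such that each of x, y, z is generic over the
   support of the comparison of the other two. Interpolating
   [x < y] & [y < z] <= [x < z] then gives an r that is a finite join of
   rectangles u & v with u depending on x only and v on z only; as y is generic,
   r lies above each [x = 2j] & [z = 2j+2], and a pigeonhole argument
   contradicts r <= [x < z]. *)

Require Import Defs.
From HB Require Import structures.
From mathcomp Require Import all_boot all_order.
From Stdlib Require Inverse_Image.
From mathcomp Require Import boolp wochoice classical_sets functions cardinality.

Set Implicit Arguments.
Unset Strict Implicit.
Unset Printing Implicit Defensive.

Import Order.Theory.
Local Open Scope classical_set_scope.
Local Open Scope card_scope.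

(** * Well-orders, comparison of cardinalities and transfinite choice *)

Definition strict_wo (T : Type) (R : T -> T -> Prop) : Prop :=
  [/\ well_founded R, forall x y z, R x y -> R y z -> R x z &
      forall x y, [\/ R x y, x = y | R y x]].

Lemma well_order_strict (T : eqType) (r : rel T) :
  well_order r -> strict_wo (fun x y => r x y && (x != y)).
Proof.
move=> wo; have woT : wo_chain r predT by apply: withinW.
have tot : total r by move=> x y; apply: (wo_chainW woT).
have anti : antisymmetric r.
  by move=> x y; apply: (wo_chain_antisymmetric woT).
have least (A : set T) : A !=set0 -> exists2 z, A z & forall x, A x -> r z x.
  move=> [x Ax]; have [|z [[Az lb] _]] := wo (mem A).
    by exists x; rewrite inE.
  by exists z => [|y Ay]; [rewrite inE in Az|apply: lb; rewrite inE].
split.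
- move=> x; apply: contrapT => nx.
  have [|z nz lb] := least [set y | ~ Acc (fun x y => r x y && (x != y)) y].
    by exists x.
  apply: nz; split=> y /andP[yz ny]; apply: contrapT => /lb zy.
  by case/negP: ny; apply/eqP/anti; rewrite yz zy.
- move=> x y z /andP[xy nxy] /andP[yz nyz]; apply/andP.
  have [w ww lb] := least (x |` [set y; z])
    (ex_intro _ x (or_introl (erefl x))).
  have wx : r w x by apply: lb; left.
  have wy : r w y by apply: lb; right; left.
  have wz : r w z by apply: lb; right; right.
  case: ww => [|[|]] /= ww; subst w.
  + split=> //; apply/negP => /eqP xz; subst z.
    by case/negP: nxy; apply/eqP/anti; rewrite xy yz.
  + by case/negP: nxy; apply/eqP/anti; rewrite xy.
  + by case/negP: nyz; apply/eqP/anti; rewrite yz.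
- move=> x y; have [->|nxy] := eqVneq x y; first by constructor 2.
  have /orP[xy|yx] := tot x y; first by constructor 1; rewrite xy.
  by constructor 3; rewrite yx.
Qed.

Lemma exists_strict_wo (T : Type) : exists R : T -> T -> Prop, strict_wo R.
Proof.
elim/Peq: T => T; have [r /well_order_strict wo] := well_ordering_principle T.
by exists (fun x y => r x y && (x != y)).
Qed.

(** A multivalued map whose values at distinct points never meet is enough, since any choice of
    values is injective. *)
Lemma card_le_rel (T U : Type) (A : set T) (B : set U) (r : T -> U -> Prop) :
    (forall x, A x -> exists2 y, B y & r x y) ->
    (forall x x' y, A x -> A x' -> B y -> r x y -> r x' y -> x = x') ->
  A #<= B.
Proof.
elim/Ppointed: T => T in A r *; first by rewrite !emptyE_subdef.
elim/Ppointed: U => U in B r *.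
  move=> ex _; have -> : A = set0 by rewrite -subset0 => x /ex[y]; case: (no y).
  exact: card_ge0.
move=> ex inj.
have [x|f fP] := @choice T U (fun x y => A x -> B y /\ r x y).
  have [/ex[y By rxy]|nAx] := pselect (A x); first by exists y.
  by exists point.
apply/pcard_leP/injfunPex; exists f.
  by move=> x /fP[].
move=> x x' /set_mem Ax /set_mem Ax'.
have [Bx rx] := fP x Ax; have [_ rx'] := fP x' Ax'.
by move=> e; apply: (inj x x' (f x)) => //; rewrite e.
Qed.

Lemma card_le_inj (T U : Type) (A : set T) (B : set U) (f : T -> U) :
    (forall x, A x -> B (f x)) ->
    (forall x x', A x -> A x' -> f x = f x' -> x = x') ->
  A #<= B.
Proof.
move=> fun_f inj_f; apply: (card_le_rel (r := fun x y => f x = y)).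
  by move=> x /fun_f Bfx; exists (f x).
by move=> x x' _ Ax Ax' _ <- /esym; apply: inj_f.
Qed.

Lemma card_leTP (T U : Type) (A : set T) : A #<= [set: U] ->
  exists r : T -> U -> Prop, (forall x, A x -> exists y, r x y) /\
    forall x x' y, r x y -> r x' y -> x = x'.
Proof.
move=> /card_leP[f].
exists (fun x y => exists h : x \in A, y = val (f (exist _ x h))); split.
  by move=> x /mem_set Ax; exists (val (f (exist _ x Ax))); exists Ax.
move=> x x' y [h ->] [h' /val_inj e].
by have /(congr1 val) := 'inj_f (mem_set I) (mem_set I) e.
Qed.

Section TransfiniteChoice.
Variables (W : Type) (R : W -> W -> Prop).

Definition initial_segment (w : W) : set W := [set v | R v w].

(** Well-founded recursion in which stage [w] sees only the set of earlier values, an image of the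
    initial segment; this gives the size bound available when the next value is chosen. *)
Lemma transfinite_choice (T : Type) (P : W -> set T -> T -> Prop) :
    well_founded R ->
    (forall w A, A #<= initial_segment w -> exists t, P w A t) ->
  exists f : W -> T, forall w, P w (f @` initial_segment w) (f w).
Proof.
move=> wf ex.
pose past w (g : forall v, R v w -> T) : set T :=
  [set t | exists v (h : R v w), g v h = t].
have small w g : past w g #<= initial_segment w.
  apply: (card_le_rel (r := fun t v => exists h, g v h = t)).
    by move=> t [v [h <-]]; exists v => //; exists h.
  by move=> t t' v _ _ _ [h <-] [h' <-]; rewrite (Prop_irrelevance h h').
pose next w g := projT1 (cid (ex w _ (small w g))).
exists (Fix wf (fun=> T) next) => w; rewrite Fix_eq; last first.
  move=> v g g' gg'; congr next.
  by apply: functional_extensionality_dep => u; apply/funext.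
rewrite /next; case: cid => t /=.
suff -> : past w (fun v _ => Fix wf (fun=> T) next v) =
  Fix wf (fun=> T) next @` initial_segment w by [].
by apply/seteqP; split=> [_ [v [h <-]]|_ [v h <-]]; exists v => //; exists h.
Qed.

End TransfiniteChoice.

(** Along a well-order of the first type, choose values not taken before as long as there are any.
    Either some initial segment exhausts the second type, or all choices are distinct. *)
Lemma card_le_total (T U : Type) (A : set T) (B : set U) : A #<= B \/ B #<= A.
Proof.
rewrite -(card_le_eql (card_setT A)) -(card_le_eqr (card_setT B)).
rewrite -(card_le_eql (card_setT B)) -(card_le_eqr (card_setT A)).
move: (set_type A) (set_type B) => {A B}T {}U.
have [R [wf tr tot]] := exists_strict_wo T.
have [[u0 _]|/forallNP noU] := pselect (exists u : U, True); last first.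
  right; have -> : [set: U] = set0 by rewrite -subset0 => u; case: (noU u).
  exact: card_ge0.
have [|f fP] := @transfinite_choice T R U (fun _ A u => A <> setT -> ~ A u) wf.
  move=> w A _.
  have [->|/setTPn[u nAu]] := eqVneq A setT; first by exists u0.
  by exists u.
have [[w wT]|/forallNP prop] :=
  pselect (exists w, f @` initial_segment R w = setT).
  right; rewrite -wT; apply: card_le_trans (card_image_le _ _) _.
  exact: card_leT.
left; apply: (card_le_inj (f := f)) => // x y _ _ fxy.
have neq v w : R v w -> f v <> f w.
  by move=> vw e; apply: (fP w (prop w)); exists v.
by case: (tot x y) => // [/neq|/neq/nesym].
Qed.

Lemma card_ltNge (T U : Type) (A : set T) (B : set U) :
  card_lt A B <-> ~ (B #<= A).
Proof.
rewrite /card_lt card_eq_le; split=> [/andP[-> /=]/negP//|nBA].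
have [AB|//] := card_le_total A B.
by rewrite AB; apply/negP.
Qed.

Lemma not_card_le_powerset (K : Type) : ~ ([set: set K] #<= [set: K]).
Proof.
move=> /card_leTP[r [tot inj]].
pose D : set K := [set k | exists2 X, r X k & ~ X k].
have [k rDk] := tot D I.
have nDk : ~ D k by move=> Dk; case: (Dk) => X rXk; rewrite (inj _ _ _ rXk rDk).
by apply: (nDk); exists D.
Qed.

(** * Successor cardinals *)

(** At stage [w] at most |K| elements of [B] have been used, so a new one remains. *)
Lemma greedy_injection (W : Type) (R : W -> W -> Prop) (K T : Type)
    (B : set T) : strict_wo R ->
    (forall w, initial_segment R w #<= [set: K]) -> ~ (B #<= [set: K]) ->
  [set: W] #<= B.
Proof.
move=> [wf tr tot] segK nBK.
have [|f fP] := @transfinite_choice W R T (fun _ A t => B t /\ ~ A t) wf.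
  move=> w A Aw; apply: contrapT => /forallNP noT; apply: nBK.
  apply: card_le_trans (card_le_trans Aw (segK w)); apply: subset_card_le.
  by move=> t Bt; apply: contrapT => nAt; apply: (noT t).
apply: (card_le_inj (f := f)) => [w _|x y _ _ fxy]; first by case: (fP w).
have neq v w : R v w -> f v <> f w.
  by move=> vw e; apply: (fP w).2; exists v.
by case: (tot x y) => // [/neq|/neq/nesym].
Qed.

(* [W] ordered by [R] has order type |K|^+ when its initial segments have
   cardinality at most |K|. *)
Definition succ_wo (K W : Type) (R : W -> W -> Prop) : Prop :=
  [/\ strict_wo R, forall w, initial_segment R w #<= [set: K] &
      ~ ([set: W] #<= [set: K])].

(** Hartogs' construction inside [set K]: keep the set [D] of points whose initial segments have
    size at most |K|. If [D] were that small too, induction would put every point in [D], against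
    Cantor. *)
Lemma exists_succ_wo (K : Type) :
  exists (W : Type) (R : W -> W -> Prop), succ_wo K R.
Proof.
have [R [wf tr tot]] := exists_strict_wo (set K).
pose D : set (set K) := [set x | initial_segment R x #<= [set: K]].
exists {x | D x}, (fun x y => R (sval x) (sval y)); split.
- split; first exact: Inverse_Image.wf_inverse_image.
  + by move=> x y z; apply: tr.
  + move=> [x Dx] [y Dy] /=; case: (tot x y).
    * by constructor 1.
    * by move=> xy; subst y; constructor 2; congr exist; apply: Prop_irrelevance.
    * by constructor 3.
- move=> [x Dx]; apply: card_le_trans (Dx : initial_segment R x #<= _).
  apply: (card_le_inj (f := @sval _ _)) => // -[y Dy] [z Dz] _ _ /= yz; subst z.
  by congr exist; apply: Prop_irrelevance.
- move=> smallD.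
  have DK : D #<= [set: K].
    apply: card_le_trans smallD.
    apply: (card_le_rel (r := fun x y => x = sval y)).
      by move=> x Dx; exists (exist _ x Dx).
    by move=> x x' y _ _ _ -> ->.
  suff all x : D x.
    apply: (@not_card_le_powerset K); apply: card_le_trans DK.
    by apply: subset_card_le => x _; apply: all.
  elim/(well_founded_ind wf): x => x IH.
  exact: card_le_trans (subset_card_le IH) DK.
Qed.

Lemma succ_wo_successor (K W : Type) (R : W -> W -> Prop) :
  succ_wo K R -> card_successor K W.
Proof.
move=> [wo segK nWK]; split; first exact/card_ltNge.
by move=> X /card_ltNge; apply: greedy_injection wo segK.
Qed.

Lemma strict_wo_lex (T U : Type) (R : T -> T -> Prop) (S : U -> U -> Prop) :
    strict_wo R -> strict_wo S ->
  strict_wo (fun p q : T * U => R p.1 q.1 \/ p.1 = q.1 /\ S p.2 q.2).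
Proof.
move=> [wfR trR totR] [wfS trS totS]; split.
- move=> [x y]; elim/(well_founded_ind wfR): x y => x IHx y.
  elim/(well_founded_ind wfS): y => y IHy.
  by split=> -[x' y'] /= [/IHx//|[-> /IHy]].
- move=> [a b] [a' b'] [a'' b''] /= [aa'|[-> bb']] [a'a''|[<- b'b'']].
  + by left; apply: trR aa' a'a''.
  + by left.
  + by left.
  + by right; split=> //; apply: trS bb' b'b''.
- move=> [a b] [a' b']; case: (totR a a') => [aa'|<-|a'a].
  + by constructor 1; left.
  + case: (totS b b') => [bb'|<-|b'b].
    * by constructor 1; right.
    * by constructor 2.
    * by constructor 3; right.
  + by constructor 3; left.
Qed.

Lemma strict_wo_preimage (T U : Type) (R : U -> U -> Prop) (f : T -> U) :
  strict_wo R -> injective f -> strict_wo (fun x y => R (f x) (f y)).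
Proof.
move=> [wf tr tot] inj; split; first exact: Inverse_Image.wf_inverse_image.
  by move=> x y z; apply: tr.
move=> x y; case: (tot (f x) (f y)); first by constructor 1.
  by move=> /inj; constructor 2.
by constructor 3.
Qed.

(** * Sets of size at most an infinite cardinal *)

Definition square_absorbing (K : Type) : Prop :=
  [set: nat] #<= [set: K] /\ [set: K * K] #<= [set: K].

Section SmallSets.
Variables (K : Type) (sqK : square_absorbing K).

Lemma countable_small (T : Type) (A : set T) : countable A -> A #<= [set: K].
Proof. by move=> cA; apply: card_le_trans cA sqK.1. Qed.

Lemma bigcup_small (I T : Type) (D : set I) (F : I -> set T) :
    D #<= [set: K] -> (forall i, D i -> F i #<= [set: K]) ->
  \bigcup_(i in D) F i #<= [set: K].
Proof.
move=> /card_leTP[r [tr ir]] smallF.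
have [i|s sP] := @choice I (T -> K -> Prop) (fun i s => D i ->
    (forall x, F i x -> exists y, s x y) /\
    forall x x' y, s x y -> s x' y -> x = x').
  have [/smallF/card_leTP[s sP]|nDi] := pselect (D i); first by exists s.
  by exists (fun _ _ => True).
apply: card_le_trans sqK.2.
apply: (card_le_rel (r := fun x p => exists i, [/\ D i, r i p.1 & s i x p.2])).
  move=> x [i Di Fix]; have [j rij] := tr i Di.
  by have [y sxy] := (sP i Di).1 x Fix; exists (j, y) => //; exists i.
move=> x x' [j y] _ _ _ [i [/= Di rij sxy]] [i' [/= _ ri'j sxy']].
by move: sxy'; rewrite -(ir _ _ _ rij ri'j); apply: (sP i Di).2.
Qed.

Lemma setU_small (T : Type) (A B : set T) :
  A #<= [set: K] -> B #<= [set: K] -> A `|` B #<= [set: K].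
Proof.
move=> sA sB; rewrite -bigcup2E; apply: bigcup_small => [|[|[|n]] _] //=.
exact: countable_small.
Qed.

Lemma image2_small (T U V : Type) (f : T -> U -> V) (A : set T) (B : set U) :
    A #<= [set: K] -> B #<= [set: K] ->
  [set z | exists x y, [/\ A x, B y & z = f x y]] #<= [set: K].
Proof.
move=> sA sB.
have -> : [set z | exists x y, [/\ A x, B y & z = f x y]] =
    \bigcup_(x in A) (f x @` B).
  apply/seteqP; split=> [_ [x [y [Ax By ->]]]|_ [x Ax [y By <-]]].
    by exists x => //; exists y.
  by exists x, y.
apply: bigcup_small => // x _; exact: card_le_trans (card_image_le _ _) sB.
Qed.

(** Goedel's order of pairs, by maximum [m p] and then lexicographically. The pairs before [p] have
    both coordinates in the set [C] of points up to [m p], hence number at most |K|;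
    [greedy_injection] then maps the pairs into [W]. *)
Lemma succ_wo_square (W : Type) (R : W -> W -> Prop) :
  succ_wo K R -> square_absorbing W.
Proof.
move=> [wo segK nWK]; split.
  have [//|WN] := card_le_total [set: nat] [set: W].
  by case: nWK; apply: countable_small.
pose m (p : W * W) := if pselect (R p.1 p.2) then p.2 else p.1.
have woL := strict_wo_preimage (f := fun p : W * W => (m p, p))
  (strict_wo_lex wo (strict_wo_lex wo wo)) (fun p q e => congr1 snd e).
apply: (greedy_injection woL _ nWK) => p.
have [_ tr tot] := wo.
have mP q : (q.1 = m q \/ R q.1 (m q)) /\ (q.2 = m q \/ R q.2 (m q)).
  rewrite /m; case: pselect => [q12|nq12]; first by split; [right|left].
  split; first by left.
  by case: (tot q.1 q.2) => //; [left|right].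
pose C := m p |` initial_segment R (m p).
have sC : C #<= [set: K] by apply: setU_small => //; apply: countable_small.
apply: card_le_trans (image2_small pair sC sC); apply: subset_card_le.
have Cq w q : w = m q \/ R w (m q) -> R (m q) (m p) \/ m q = m p -> C w.
  move=> [->|wq] [qp|qp]; rewrite /C /= ?qp.
  - by right.
  - by left.
  - by right; apply: tr qp.
  - by right; rewrite -qp.
move=> q; rewrite /initial_segment /= => qp; exists q.1, q.2.
have {}qp : R (m q) (m p) \/ m q = m p by case: qp => [|[]]; [left|right].
by have [m1 m2] := mP q; split; [exact: Cq m1 qp|exact: Cq m2 qp|case: (q)].
Qed.

End SmallSets.

Lemma square_absorbing_nat : square_absorbing nat.
Proof. by split=> //; apply: countableP. Qed.

(** * Normal forms in a generated subalgebra *)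

Section Subalgebras.
Variables (d : Order.disp_t) (B : ctbDistrLatticeType d).
Implicit Types (S A C H : set B) (x y z : B).

Lemma generated_subalgebra H : subalgebra (generated H).
Proof.
split=> [C [[]]|C [[]]|x y Hx Hy C [sC HC]|x y Hx Hy C [sC HC]|x Hx C [sC HC]].
- by [].
- by [].
- by have [_ _ CI _ _] := sC; apply: CI; [apply: Hx|apply: Hy].
- by have [_ _ _ CU _] := sC; apply: CU; [apply: Hx|apply: Hy].
- by have [_ _ _ _ CC] := sC; apply: CC; apply: Hx.
Qed.

Lemma generated_min S H : subalgebra S -> H `<=` S -> generated H `<=` S.
Proof. exact: smallest_sub. Qed.

Lemma subset_generated H H' : H `<=` H' -> generated H `<=` generated H'.
Proof.
by move=> HH'; apply: sub_smallest2r => //; apply: generated_subalgebra.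
Qed.

Lemma subalgebra_two : subalgebra [set \bot%O; \top%O : B].
Proof.
split=> [||x y|x y|x]; [by left|by right|..].
- by move=> [->|->]; rewrite ?meet0x ?meet1x //; left.
- by move=> [->|->]; rewrite ?join0x ?join1x //; right.
- by move=> [->|->]; [rewrite compl0; right|rewrite compl1; left].
Qed.

(** The finite joins [J] of rectangles form a subalgebra: meets distribute, and by De Morgan the
    complement of such a join is a meet of elements of [J]. *)
Lemma generatedU_joins A C x : subalgebra A -> subalgebra C ->
    generated (A `|` C) x ->
  exists2 s : seq (B * B), (forall p, p \in s -> A p.1 /\ C p.2) &
    x = (\join_(p <- s) (p.1 `&` p.2))%O.
Proof.
move=> [A0 A1 AI AU AC] [C0 C1 CI CU CC].
pose J x := exists2 s : seq (B * B), (forall p, p \in s -> A p.1 /\ C p.2) &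
    x = (\join_(p <- s) (p.1 `&` p.2))%O.
have Jr u v : A u -> C v -> J (u `&` v)%O.
  move=> Au Cv; exists [:: (u, v)]; last by rewrite big_seq1.
  by move=> p; rewrite inE => /eqP->.
have JA u : A u -> J u by move=> Au; rewrite -[u]meetx1; apply: Jr.
have JC u : C u -> J u by move=> Cu; rewrite -[u]meet1x; apply: Jr.
have JU y z : J y -> J z -> J (y `|` z)%O.
  move=> [s sAC ->] [t tAC ->]; exists (s ++ t); last by rewrite big_cat.
  by move=> p; rewrite mem_cat => /orP[/sAC|/tAC].
have JrI u v z : A u -> C v -> J z -> J ((u `&` v) `&` z)%O.
  move=> Au Cv [t tAC ->]; elim: t tAC => [|p t IH] tAC.
    by rewrite big_nil meetx0; apply: JA.
  rewrite big_cons meetUr; apply: JU.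
    have [Ap Cp] := tAC p (mem_head _ _).
    by rewrite meetACA; apply: Jr; [apply: AI|apply: CI].
  by apply: IH => q qt; apply: tAC; rewrite inE qt orbT.
have JI y z : J y -> J z -> J (y `&` z)%O.
  move=> [s sAC ->] Jz; elim: s sAC => [|p s IH] sAC.
    by rewrite big_nil meet0x; apply: JA.
  rewrite big_cons meetUl; apply: JU.
    by have [Ap Cp] := sAC p (mem_head _ _); apply: JrI.
  by apply: IH => q qs; apply: sAC; rewrite inE qs orbT.
have JN y : J y -> J (~` y)%O.
  move=> [s sAC ->]; elim: s sAC => [|p s IH] sAC.
    by rewrite big_nil compl0; apply: JA.
  have [Ap Cp] := sAC p (mem_head _ _).
  rewrite big_cons complU complI; apply: JI.
    by apply: JU; [apply: JA; apply: AC|apply: JC; apply: CC].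
  by apply: IH => q qs; apply: sAC; rewrite inE qs orbT.
move=> gx; apply: (generated_min (S := J)) gx; last by move=> y [/JA|/JC].
by split=> //; apply: JA.
Qed.

Lemma generatedU_join_ind A C (P : B -> Prop) : subalgebra A -> subalgebra C ->
    P \bot%O -> (forall x y, P x -> P y -> P (x `|` y)%O) ->
    (forall u v, A u -> C v -> P (u `&` v)%O) ->
  forall x, generated (A `|` C) x -> P x.
Proof.
move=> sA sC P0 PU PI x /(generatedU_joins sA sC)[s sAC ->].
elim: s sAC => [|p s IH] sAC; first by rewrite big_nil.
rewrite big_cons; apply: PU; last first.
  by apply: IH => q qs; apply: sAC; rewrite inE qs orbT.
by have [Ap Cp] := sAC p (mem_head _ _); apply: PI.
Qed.

(** Dual to [generatedU_join_ind], by complementation. In an inequality the left side is reduced by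
    joins and the right side by meets, so that only the form [h & s <= k | t] remains. *)
Lemma generatedU_meet_ind A C (P : B -> Prop) : subalgebra A -> subalgebra C ->
    P \top%O -> (forall x y, P x -> P y -> P (x `&` y)%O) ->
    (forall u v, A u -> C v -> P (u `|` v)%O) ->
  forall x, generated (A `|` C) x -> P x.
Proof.
move=> sA sC P1 PI PU x gx; rewrite -[x]complK.
have {gx} : generated (A `|` C) (~` x)%O.
  by have [_ _ _ _] := generated_subalgebra (A `|` C); apply.
move: (~` x)%O; apply: (generatedU_join_ind sA sC); rewrite ?compl0 //.
  by move=> y z Py Pz; rewrite complU; apply: PI.
have [_ _ _ _ AC] := sA; have [_ _ _ _ CC] := sC.
by move=> u v Au Cv; rewrite complI; apply: PU; [apply: AC|apply: CC].
Qed.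

End Subalgebras.

(** * Spans of index sets, and the skeleton of a filtration *)

Section Spans.
Variables (d : Order.disp_t) (B : ctbDistrLatticeType d).
Variables (I : Type) (S : I -> set B).
Implicit Types (H K : set I) (x y : B).

Definition span H : set B := generated (\bigcup_(i in H) S i).

Lemma span_subalgebra H : subalgebra (span H).
Proof. exact: generated_subalgebra. Qed.

Lemma spanS H K : H `<=` K -> span H `<=` span K.
Proof. by move=> HK; apply: subset_generated; apply: bigcup_subset. Qed.

Lemma mem_span H i x : H i -> S i x -> span H x.
Proof. by move=> Hi Six; apply: sub_gen_smallest; exists i. Qed.

(** A directed union of subalgebras is a subalgebra; [D] is nonempty so that the union contains the
    bounds. *)
Lemma span_directed (T : Type) (D : set T) (H : T -> set I) (K : set I) :
    D !=set0 ->
    (forall s t, D s -> D t ->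
      exists u, [/\ D u, H s `<=` H u & H t `<=` H u]) ->
    K `<=` \bigcup_(t in D) H t ->
  span K `<=` \bigcup_(t in D) span (H t).
Proof.
move=> [t0 Dt0] dir KH; set P := \bigcup_(t in D) span (H t).
have PU (f : B -> B -> B) y z : (forall C u v, span C u -> span C v ->
    span C (f u v)) -> P y -> P z -> P (f y z).
  move=> spanf [s Ds sy] [t Dt tz].
  have [u [Du su tu]] := dir s t Ds Dt.
  by exists u => //; apply: spanf; [apply: spanS sy|apply: spanS tz].
apply: generated_min => [|y [i Ki Siy]]; last first.
  by have [t Dt Hti] := KH i Ki; exists t => //; apply: mem_span Siy.
split.
- exists t0 => //; by have [] := span_subalgebra (H t0).
- exists t0 => //; by have [] := span_subalgebra (H t0).
- by move=> y z; apply: PU => C u v; case: (span_subalgebra C) => _ _ + _ _;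
    apply.
- by move=> y z; apply: PU => C u v; case: (span_subalgebra C) => _ _ _ + _;
    apply.
- move=> y [t Dt ty]; exists t => //.
  by case: (span_subalgebra (H t)) => _ _ _ _; apply.
Qed.

Lemma span_countable_support H x :
  span H x -> exists C, [/\ countable C, C `<=` H & span C x].
Proof.
move=> /(span_directed (D := [set C | countable C /\ C `<=` H]) (H := id)).
case=> [||i Hi|C [cC CH] Cx]; last by exists C.
- by exists set0; split.
- move=> s t [cs sH] [ct tH]; exists (s `|` t); split.
  + split; last by rewrite subUset.
    by rewrite -bigcup2E; apply: bigcup_countable => // -[|[|n]] _ /=.
  + exact: subsetUl.
  + exact: subsetUr.
- by exists [set i] => //; split=> // _ ->.
Qed.

Lemma span_setU H K : span (H `|` K) `<=` generated (span H `|` span K).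
Proof.
apply: generated_min => [|x [i HKi Six]]; first exact: generated_subalgebra.
apply: sub_gen_smallest.
by case: HKi => [Hi|Ki]; [left; apply: mem_span Six|right; apply: mem_span Six].
Qed.

End Spans.

(** A filtration is replaced by its countable increments: stage [i] is the span of the indices
    before [i], and [skel_pushout] is the interpolation clause of the push-out that adjoins
    [S i]. *)
Record skeleton (d : Order.disp_t) (B : ctbDistrLatticeType d) (I : Type)
    (R : I -> I -> Prop) (S : I -> set B) : Prop := Skeleton {
  skel_wo : strict_wo R;
  skel_countable : forall i, countable (S i);
  skel_subalgebra : forall i, subalgebra (S i);
  skel_full : forall x, span S setT x;
  skel_pushout : forall i a s, span S (initial_segment R i) a -> S i s ->
    (a <= s)%O -> exists r,
      [/\ span S (initial_segment R i) r, S i r, (a <= r)%O & (r <= s)%O]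
}.

Lemma filtered_skeleton (d : Order.disp_t) (B : ctbDistrLatticeType d) :
  tightly_sigma_filtered B ->
  exists (I : Type) (R : I -> I -> Prop) (S : I -> set B), skeleton R S.
Proof.
move=> [dL [L [F [woL [subF [monoF [F0 [F1 [Fsucc Flim]]]]]]]]].
pose R (a b : L) : Prop := (a < b)%O.
have [a|S SP] := @choice L (set B) (fun a S => [/\ countable S, subalgebra S &
    forall b, is_succ a b -> pushout (F b) S (F a)] /\
    ((forall b, ~ is_succ a b) -> S = [set \bot%O; \top%O])).
  have [[b sab]|nsa] := pselect (exists b, is_succ a b).
    have [S [cS poS]] := Fsucc a b sab; exists S; split; last first.
      by move=> /(_ b).
    split=> // [|c sac]; first by case: poS.
    suff -> : c = b by [].
    apply/eqP/negP => /negP; have [ab minb] := sab; have [ac minc] := sac.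
    by rewrite neq_lt => /orP[cb|bc]; [apply: (minb c)|apply: (minc b)].
  exists [set \bot%O; \top%O]; split=> //; split.
  - exact/finite_set_countable/finite_set2.
  - exact: subalgebra_two.
  - by move=> b sab; case: nsa; exists b.
have wo : strict_wo R.
  have -> : R = fun x y => (x <= y)%O && (x != y).
    by apply/funext=> a; apply/funext=> b; rewrite /R lt_neqAle andbC.
  exact: well_order_strict.
(* Induction on [b]: at zero both sides are the constants, at successors the push-out is generated
   by the new piece, at limits [span_directed] applies. *)
have FE b : F b = span S (initial_segment R b).
  case: wo => wf tr tot; elim/(well_founded_ind wf): b => b IH.
  have FS a : R a b -> F a `<=` span S (initial_segment R b).
    move=> ab; rewrite IH //; apply: spanS => c /tr; exact.
  have segF x : (exists2 a, R a b & F a x) \/ x = \bot%O \/ x = \top%O ->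
    span S (initial_segment R b) x.
    case=> [[a /FS]|]; first exact.
    by case: (span_subalgebra S (initial_segment R b)) => ? ? _ _ _ [->|->].
  have [->|b0] := pselect (b = \bot%O).
    rewrite F0; apply/seteqP; split=> x.
      by case: (span_subalgebra S (initial_segment R \bot%O)) => ? ? _ _ _;
        case=> ->.
    move: x; apply: generated_min => [|x [a]]; first exact: subalgebra_two.
    by rewrite /initial_segment /R /= ltx0.
  have [[a sab]|nsb] := pselect (exists a, is_succ a b).
    have [ab minab] := sab.
    have segE : initial_segment R b = a |` initial_segment R a.
      apply/seteqP; split=> c; rewrite /initial_segment /= => cb.
        by case: (tot c a) => // [ca|->|ac]; [right|left|case: (minab c)].
      by case: cb => [->|ca] //; apply: tr ab.
    have [[_ _ /(_ b sab)[sS sF -> po]] _] := SP a; rewrite segE.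
    apply/seteqP; split.
      apply: generated_min => [|x [Sx|Fx]]; first exact: generated_subalgebra.
        by apply: mem_span Sx; left.
      by rewrite IH // in Fx; apply: spanS Fx => c; right.
    apply: subset_trans (@span_setU _ _ _ _ _ _) _.
    apply: generated_min => [|x [Sx|]]; first exact: generated_subalgebra.
      move: x Sx; apply: generated_min => [|x [_ -> Sx]].
        exact: generated_subalgebra.
      by apply: sub_gen_smallest; left.
    by rewrite -IH // => Fx; apply: sub_gen_smallest; right.
  have limb : is_limit b by split=> // a sab; apply: nsb; exists a.
  rewrite (Flim _ limb); apply/seteqP; split=> x.
    by move=> [a ab Fax]; apply: FS Fax.
  have lim c : R c b -> exists2 e, R c e & R e b.
    move=> cb; apply: contrapT => ne; apply: (limb.2 c); split=> // e [ce eb].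
    by apply: ne; exists e.
  move=> /(span_directed (D := [set a | R a b]) (H := initial_segment R)).
  case=> [|s t sb tb|c /lim[e ce eb]|a ab ax]; last by exists a; rewrite // IH.
  - by exists \bot%O; rewrite /R /= lt0x; apply/eqP.
  - case: (tot s t) => [st|<-|ts].
    + by exists t; split=> // c /tr; apply.
    + by exists s; split.
    + by exists s; split=> // c /tr; apply.
  - by exists e.
exists L, R, S; split=> //.
- by move=> a; have [[]] := SP a.
- by move=> a; have [[]] := SP a.
- move=> x; apply: (spanS (H := initial_segment R \top%O)) => //.
  by rewrite -FE F1.
move=> a x s; rewrite -FE => Fx Ss xs.
have [[b sab]|nsa] := pselect (exists b, is_succ a b).
  have [[_ _ /(_ b sab)[_ _ _ po]] _] := SP a.
  by have [r [[Fr Sr] xr rs]] := po x s Fx Ss xs; exists r.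
(* An index without successor, such as the top of [L], carries only the constants; there [s] is its
   own interpolant. *)
have SE : S a = [set \bot%O; \top%O].
  by apply: (SP a).2 => b sab; apply: nsa; exists b.
have [F00 F11 _ _ _] := subF a; move: Ss xs; rewrite SE => -[] -> xs.
- by exists \bot%O; split=> //; left.
- by exists \top%O; split=> //; right.
Qed.

(** * Interpolation over closed supports *)

Section Commutation.
Variables (d : Order.disp_t) (B : ctbDistrLatticeType d).
Variables (I : Type) (R : I -> I -> Prop) (S : I -> set B).
Hypothesis skel : skeleton R S.
Variable E : I -> set I.
Hypothesis E_countable : forall i, countable (E i).
Hypothesis E_before : forall i, E i `<=` initial_segment R i.
Hypothesis E_support : forall i x,
  span S (initial_segment R i) x -> S i x -> span S (E i) x.
Implicit Types (H K : set I) (x y : B).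

(** Elements of [S i] already generated before [i] are supported by [E i]. Closure keeps them, in
    particular the interpolants at [i], inside [span S H] whenever [H i]. *)
Definition closed_support H : Prop := forall i, H i -> E i `<=` H.

Lemma closed_supportI H K :
  closed_support H -> closed_support K -> closed_support (H `&` K).
Proof.
by move=> cH cK i [/cH EH /cK EK] j Ej; split; [apply: EH|apply: EK].
Qed.

Lemma closed_support_bigcup (T : Type) (D : set T) (H : T -> set I) :
  (forall t, D t -> closed_support (H t)) ->
  closed_support (\bigcup_(t in D) H t).
Proof. by move=> cH i [t Dt Hti] j Eij; exists t => //; apply: cH Eij. Qed.

Lemma closed_supportU H K :
  closed_support H -> closed_support K -> closed_support (H `|` K).
Proof.
move=> cH cK i [/cH EH|/cK EK] j Ej; first by left; apply: EH.
by right; apply: EK.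
Qed.

Lemma countable_closed_support H : countable H ->
  exists K, [/\ countable K, closed_support K & H `<=` K].
Proof.
move=> cH; pose next K := \bigcup_(i in K) E i.
exists (\bigcup_n iter n next H); split.
- apply: bigcup_countable => // n _; elim: n => //= n IH.
  exact: bigcup_countable.
- by move=> i [n _ ni] j Eij; exists n.+1 => //; exists i.
- by move=> i Hi; exists 0.
Qed.

Definition interpolated H x y : Prop :=
  exists r, [/\ span S H r, (x <= r)%O & (r <= y)%O].

Lemma interpolated0 H y : interpolated H \bot%O y.
Proof. by exists \bot%O; split=> //; case: (span_subalgebra S H). Qed.

Lemma interpolated1 H x : interpolated H x \top%O.
Proof. by exists \top%O; split=> //; case: (span_subalgebra S H). Qed.

Lemma interpolatedU H x x' y :
  interpolated H x y -> interpolated H x' y -> interpolated H (x `|` x')%O y.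
Proof.
move=> [r [Hr xr ry]] [r' [Hr' xr' ry']]; exists (r `|` r')%O; split.
- by case: (span_subalgebra S H) => _ _ _ + _; apply.
- by rewrite leU2.
- by rewrite leUx ry.
Qed.

Lemma interpolatedI H x y y' :
  interpolated H x y -> interpolated H x y' -> interpolated H x (y `&` y')%O.
Proof.
move=> [r [Hr xr ry]] [r' [Hr' xr' ry']]; exists (r `&` r')%O; split.
- by case: (span_subalgebra S H) => _ _ + _ _; apply.
- by rewrite lexI xr.
- by rewrite leI2.
Qed.

Lemma interpolatedS H K x y :
  H `<=` K -> interpolated H x y -> interpolated K x y.
Proof. by move=> HK [r [/(spanS HK) Kr xr ry]]; exists r. Qed.

Let seg i := initial_segment R i.
Let seg' i := i |` initial_segment R i.

(* The push-out condition at [i] gives [q] in both spans with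
   [h `\` k <= q <= t `|` ~` s], which separates the old part from [S i]. *)
Lemma interpolation_step i H K h k s t :
    closed_support H -> closed_support K ->
    (forall x y, span S (H `&` seg i) x -> span S (K `&` seg i) y ->
       (x <= y)%O -> interpolated (H `&` K `&` seg i) x y) ->
    span S (H `&` seg i) h -> span S (K `&` seg i) k ->
    S i s -> (H i \/ s = \bot%O \/ s = \top%O) ->
    S i t -> (K i \/ t = \bot%O \/ t = \top%O) ->
    (h `&` s <= k `|` t)%O ->
  interpolated (H `&` K `&` seg' i) (h `&` s)%O (k `|` t)%O.
Proof.
move=> cH cK IH Hh Kk Ss Hs St Kt hskt.
have [_ _ segI segU segC] := span_subalgebra S (seg i).
have [_ _ HI HU HC] := span_subalgebra S (H `&` seg i).
have [_ _ KI KU KC] := span_subalgebra S (K `&` seg i).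
have [_ _ SI SU SC] := skel_subalgebra skel i.
have seg'S : H `&` K `&` seg i `<=` H `&` K `&` seg' i.
  by move=> j [HKj ji]; split=> //; right.
have [q [segq Sq hq qt]] : exists q, [/\ span S (seg i) q, S i q,
    (h `\` k <= q)%O & (q <= t `|` ~` s)%O].
  apply: (skel_pushout skel).
  - rewrite diffE; apply: segI; [|apply: segC].
      by apply: spanS Hh => j [].
    by apply: spanS Kk => j [].
  - by apply: SU => //; apply: SC.
  - by rewrite leBLR joinA [((k `|` t) `|` _)%O]joinC -leBLR diffE complK.
have Eq := E_support segq Sq.
have Hq : H i -> span S (H `&` seg i) q.
  move=> Hi; apply: spanS Eq => j Ej; split; first exact: cH Ej.
  exact: E_before Ej.
have Kq : K i -> span S (K `&` seg i) q.
  move=> Ki; apply: spanS Eq => j Ej; split; first exact: cK Ej.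
  exact: E_before Ej.
have qst : (q `&` s <= t)%O.
  by move: qt; rewrite -(complK s) -diffE leBLR complK joinC.
(* For [i] in [H] the element [q] can be moved to the left, as [h \ q <= k]; for [i] in [K] to the
   right, as [h <= k | q]. Both are comparisons below [i], covered by [IH]. *)
have [Hi|nHi] := pselect (H i).
  have Hhq : span S (H `&` seg i) (h `\` q)%O.
    by rewrite diffE; apply: HI => //; apply: HC; apply: Hq.
  have [|r0 [Hr0 hr0 r0k]] := IH _ _ Hhq Kk.
    by rewrite leBLR joinC -leBLR.
  have [Ki|nKi] := pselect (K i).
    have [_ _ HKI HKU _] := span_subalgebra S (H `&` K `&` seg' i).
    (* Here [q] belongs to both spans: [h <= r0 | q], while [r0 <= k] and [q & s <= t]. *)
    exists ((r0 `|` q) `&` s)%O; split.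
    + apply: HKI; last by apply: mem_span Ss; split=> //; left.
      apply: HKU; first exact: spanS Hr0.
      apply: spanS Eq => j Ej; split.
        by split; [apply: cH Ej|apply: cK Ej].
      by right; apply: E_before Ej.
    + by rewrite leI2 // joinC -leBLR.
    + by rewrite meetUl leU2 // leIxl.
  case: Kt => [//|[t0|->]]; last by rewrite joinx1; apply: interpolated1.
  apply: (interpolatedS seg'S); exists r0; split=> //.
    apply: le_trans hr0; rewrite diffE leI2 // lexC -disj_leC.
    by rewrite -lex0 -t0.
  by rewrite lexUl.
case: Hs => [//|[->|s1]]; first by rewrite meetx0; apply: interpolated0.
have qt' : (q <= t)%O by move: qst; rewrite s1 meetx1.
have [Ki|nKi] := pselect (K i).
  have [|r0 [Hr0 hr0 r0k]] := IH _ _ Hh (KU _ _ Kk (Kq Ki)).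
    by rewrite -leBLR.
  apply: (interpolatedS seg'S); exists r0; split=> //.
    by rewrite s1 meetx1.
  by apply: le_trans r0k _; rewrite leU2.
case: Kt => [//|[t0|->]]; last by rewrite joinx1; apply: interpolated1.
apply: (interpolatedS seg'S); rewrite t0 s1 meetx1 joinx0.
by apply: IH => //; move: hskt; rewrite t0 s1 meetx1 joinx0.
Qed.

(** Induction along [R] on a bound [seg' i] for both supports. The share of [S i] is split off, both
    sides are put in normal form, and [interpolation_step] settles the basic case. *)
Lemma span_interpolation H K x y :
    closed_support H -> closed_support K ->
    span S H x -> span S K y -> (x <= y)%O ->
  interpolated (H `&` K) x y.
Proof.
move=> cH cK.
have [wf tr tot] := skel_wo skel.
pose Q D := forall H K x y, closed_support H -> closed_support K ->
  span S (H `&` D) x -> span S (K `&` D) y -> (x <= y)%O ->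
  interpolated (H `&` K `&` D) x y.
have seg'_sub a b : R a b -> seg' a `<=` seg' b.
  by move=> ab c [->|ca]; right => //; apply: tr ab.
have bounded D H' z : span S (H' `&` D) z -> z = \bot%O \/ z = \top%O \/
    exists2 j, D j & span S (H' `&` seg' j) z.
  have [[j0 [H'j0 Dj0]]|nD] := pselect (H' `&` D !=set0); last first.
    suff: span S (H' `&` D) `<=` [set \bot%O; \top%O].
      by move=> two /two[->|->]; [left|right; left].
    apply: generated_min => [|x' [j HDj]]; first exact: subalgebra_two.
    by case: nD; exists j.
  move=> /(span_directed (D := D) (H := fun j => H' `&` seg' j)).
  case=> [|j l Dj Dl|j [H'j Dj]|j Dj jz]; last by right; right; exists j.
  - by exists j0.
  - case: (tot j l) => [jl|<-|lj].
    + by exists l; split=> //; apply: setIS; apply: seg'_sub.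
    + by exists j; split.
    + by exists j; split=> //; apply: setIS; apply: seg'_sub.
  - by exists j => //; split=> //; left.
have lift D : (forall a b, D b -> R a b -> D a) ->
    (forall j, D j -> Q (seg' j)) -> Q D.
  move=> downD QD {}H {}K {}x {}y {}cH {}cK Hx Ky xy.
  have [x0|[x1|[j Dj jx]]] := bounded _ _ _ Hx.
  - by rewrite x0; apply: interpolated0.
  - by move: xy; rewrite x1 le1x => /eqP->; apply: interpolated1.
  have [y0|[y1|[l Dl ly]]] := bounded _ _ _ Ky.
  - by move: xy; rewrite y0 lex0 => /eqP->; apply: interpolated0.
  - by rewrite y1; apply: interpolated1.
  have [m [Dm jm lm]] :
      exists m, [/\ D m, seg' j `<=` seg' m & seg' l `<=` seg' m].
    case: (tot j l) => [/seg'_sub jl|<-|/seg'_sub lj].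
    - by exists l; split.
    - by exists j; split.
    - by exists j; split.
  apply: (interpolatedS (H := H `&` K `&` seg' m)).
    by move=> i [HKi im]; split=> //; case: im => [->//|]; apply: downD.
  by apply: QD => //; [apply: spanS jx|apply: spanS ly]; apply: setIS.
have QT i : Q (seg' i).
  elim/(well_founded_ind wf): i => i IH {}H {}K {}x {}y {}cH {}cK Hx Ky.
  have Qi : Q (seg i) by apply: lift => [a b bi ab|//]; apply: tr ab bi.
  (* The share of [S i] in a span over [H']: all of [S i] when [H' i], and otherwise only the
     constants. *)
  pose Si H' := [set s | S i s /\ (H' i \/ s = \bot%O \/ s = \top%O)].
  have subSi H' : subalgebra (Si H').
    have [S0 S1 _ _ _] := skel_subalgebra skel i.
    have [H'i|nH'i] := pselect (H' i).
      suff -> : Si H' = S i by apply: skel_subalgebra skel i.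
      by apply/seteqP; split=> [s []//|s Ss]; split=> //; left.
    suff -> : Si H' = [set \bot%O; \top%O] by apply: subalgebra_two.
    apply/seteqP; split=> [s [_ [//|[->|->]]]|s [->|->]]; [by left|by right|..].
      by split=> //; right; left.
    by split=> //; right; right.
  have splitE H' z : span S (H' `&` seg' i) z ->
      generated (span S (H' `&` seg i) `|` Si H') z.
    move: z; apply: generated_min => [|z [j [H'j [ji|ji]] Sz]].
      exact: generated_subalgebra.
    - by apply: sub_gen_smallest; rewrite ji in H'j Sz; right; split; [|left].
    - by apply: sub_gen_smallest; left; apply: mem_span Sz.
  have sH := span_subalgebra S (H `&` seg i).
  have sK := span_subalgebra S (K `&` seg i).
  move: Hx => /splitE; move: x.
  apply: (generatedU_join_ind sH (subSi H)) => [_|x x' IHx IHx'|h s Hh [Ss Hs]].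
  - exact: interpolated0.
  - by rewrite leUx => /andP[/IHx ? /IHx' ?]; apply: interpolatedU.
  move: Ky => /splitE; move: y.
  apply: (generatedU_meet_ind sK (subSi K)) => [_|y y' IHy IHy'|k t Kk [St Kt]].
  - exact: interpolated1.
  - by rewrite lexI => /andP[/IHy ? /IHy' ?]; apply: interpolatedI.
  by apply: interpolation_step => // z w Hz Kw; apply: Qi.
have := @lift setT _ (fun j _ => QT j) H K x y cH cK.
by rewrite !setIT; apply.
Qed.

End Commutation.

(** * The contradiction from three mutually generic functions *)

Ltac meet_le :=
  first [exact: lexx | apply: leIxl; meet_le | apply: leIxr; meet_le].

Section Pieces.
Variables (d : Order.disp_t) (B : ctbDistrLatticeType d).
Implicit Types (A : set B) (a b t w x y z : B).

Lemma le_neq0 x y : (x <= y)%O -> x <> \bot%O -> y <> \bot%O.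
Proof. by move=> xy x0 y0; apply: x0; apply/eqP; rewrite -lex0 -y0. Qed.

Lemma meet_joins_neq0 (T : eqType) (s : seq T) (F : T -> B) x :
    (x <= \join_(i <- s) F i)%O -> x <> \bot%O ->
  exists2 i, i \in s & (x `&` F i)%O <> \bot%O.
Proof.
move=> xs x0; apply: contrapT => none; apply: x0.
apply/eqP; rewrite -(meetxx x) disj_leC; apply: le_trans xs _.
apply/joinsP_seq => i si _; rewrite -disj_leC meetC; apply/eqP.
by apply: contrapT => xi; apply: none; exists i.
Qed.

(* A finite substitute for an ultrafilter of [A]: a nonzero [t] deciding
   finitely many separations. *)
Lemma deciding_element A (T : eqType) (s : seq T) (a b : T -> B) :
    subalgebra A -> \top%O <> \bot%O :> B ->
    (forall i, i \in s -> exists t, [/\ A t, (a i <= t)%O & (t <= ~` b i)%O]) ->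
  exists t, [/\ A t, t <> \bot%O & forall i, i \in s ->
    (t `&` a i)%O = \bot%O \/ (t `&` b i)%O = \bot%O].
Proof.
move=> [A0 A1 AI AU AC] nontriv; elim: s => [|i s IH] sep.
  by exists \top%O; split.
have [|t [At t0 tP]] := IH.
  by move=> j sj; apply: sep; rewrite inE sj orbT.
have [u [Au au ub]] := sep i (mem_head _ _).
have [tu|tu] := pselect ((t `&` u)%O = \bot%O).
  exists t; split=> // j; rewrite inE => /orP[/eqP->|/tP//]; left.
  by apply/eqP; rewrite -lex0 -tu leI2.
exists (t `&` u)%O; split=> //; first exact: AI.
move=> j; rewrite inE => /orP[/eqP->|/tP[tj|tj]]; [right|left|right].
- apply/eqP; rewrite disj_leC; apply: le_trans ub; exact: leIr.
- by apply/eqP; rewrite -lex0 -tj leI2 // leIl.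
- by apply/eqP; rewrite -lex0 -tj leI2 // leIl.
Qed.

End Pieces.

Section Levels.
Variables (d : Order.disp_t) (B : ctbDistrLatticeType d) (q : set nat -> B).
Hypothesis q0 : q set0 = \bot%O.
Hypothesis qI : forall X Y, q (X `&` Y) = (q X `&` q Y)%O.
Hypothesis nontriv : \top%O <> \bot%O :> B.
Implicit Types (x y z : nat -> nat) (A : set B).

Definition level x n : B := q [set k | x k = n].
Definition less x y : B := q [set k | x k < y k].

Definition generic A x : Prop :=
  forall n w, A w -> w <> \bot%O -> (level x n `&` w)%O <> \bot%O.

Lemma q_mono X Y : X `<=` Y -> (q X <= q Y)%O.
Proof. by move=> /setIidPl e; rewrite leEmeet -qI e. Qed.

Lemma less_trans x y z : (less x y `&` less y z <= less x z)%O.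
Proof. by rewrite -qI; apply: q_mono => k [/=]; apply: ltn_trans. Qed.

Lemma level_less x y n m : n < m -> (level x n `&` level y m <= less x y)%O.
Proof. by move=> nm; rewrite -qI; apply: q_mono => k [/= -> ->]. Qed.

Lemma level_not_less x y n m : m <= n ->
  (level x n `&` level y m <= ~` less x y)%O.
Proof.
move=> mn; rewrite -disj_leC -!qI -q0; apply/eqP; congr q.
by rewrite -subset0 => k [[/= -> ->]]; rewrite ltnNge mn.
Qed.

Variables (I : Type) (R : I -> I -> Prop) (S : I -> set B).
Hypothesis skel : skeleton R S.
Variable E : I -> set I.
Hypothesis E_before : forall i, E i `<=` initial_segment R i.
Hypothesis E_support : forall i a,
  span S (initial_segment R i) a -> S i a -> span S (E i) a.

(** If [j < j'] share a rectangle [u & v] of [r], then [u & [x = 2j']] and [v & [z = 2j+2]] are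
    disjoint, because [u & v <= [x < z]] while [2j+2 <= 2j']. They are then separated over [U & V],
    and an element [t] deciding all these separations rules out sharing, so [r] would need more
    rectangles than it has. *)
Lemma no_free_triple x y z (Hxy Hyz Hxz : set I) :
    closed_support E Hxy -> closed_support E Hyz -> closed_support E Hxz ->
    span S Hxy (less x y) -> span S Hyz (less y z) -> span S Hxz (less x z) ->
    (forall n, span S Hxy (level x n)) -> (forall n, span S Hxz (level x n)) ->
    (forall n, span S Hyz (level z n)) -> (forall n, span S Hxz (level z n)) ->
    generic (span S Hyz) x -> generic (span S Hxz) y ->
  generic (span S Hxy) z -> False.
Proof.
move=> cxy cyz cxz lxy lyz lxz xyx xzx yzz xzz gx gy gz.
have interp := span_interpolation skel E_before E_support.
have span_setI H K a : closed_support E H -> closed_support E K ->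
    span S H a -> span S K a -> span S (H `&` K) a.
  move=> cH cK Ha Ka.
  have [r [HKr ar ra]] := interp H K a a cH cK Ha Ka (lexx a).
  by have -> : a = r by apply/eqP; rewrite eq_le ar.
pose U := Hxy `&` Hxz; pose V := Hyz `&` Hxz.
have cU : closed_support E U by apply: closed_supportI.
have cV : closed_support E V by apply: closed_supportI.
have [r [Kr lr rl]] : interpolated S ((Hxy `|` Hyz) `&` Hxz)
    (less x y `&` less y z)%O (less x z).
  apply: interp => //; [exact: closed_supportU| |exact: less_trans].
  have [_ _ HI _ _] := span_subalgebra S (Hxy `|` Hyz).
  by apply: HI; [apply: spanS lxy|apply: spanS lyz] => i; [left|right].
(* The support of [r] is [U | V], so [r] is a join of rectangles over [U], which also supports the
   levels of [x], and [V], which supports those of [z]. *)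
have [s sUV rE] : exists2 s : seq (B * B),
    (forall p, p \in s -> span S U p.1 /\ span S V p.2) &
    r = (\join_(p <- s) (p.1 `&` p.2))%O.
  apply: generatedU_joins; try exact: span_subalgebra.
  by apply: span_setU; rewrite -setIUl.
have [_ _ xyI _ xyC] := span_subalgebra S Hxy.
have [_ _ xzI _ xzC] := span_subalgebra S Hxz.
(* Where this fails, a nonzero element over [Hxz] lies outside [r]; the generic [y] takes there the
   value [2j+1], strictly between [2j] and [2j+2], and [lr] puts that piece below [r]. *)
have rect j : (level x j.*2 `&` level z j.*2.+2 <= r)%O.
  rewrite -[r]complK -disj_leC; apply/eqP; apply: contrapT => w0.
  apply: (gy j.*2.+1 _ _ w0).
    apply: (xzI); first exact: xzI.
    by apply: xzC; apply: spanS Kr => i [].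
  apply/eqP; rewrite meetA disj_leC complK; apply: le_trans lr.
  have xy : (level x j.*2 `&` level y j.*2.+1 <= less x y)%O.
    exact: level_less.
  have yz : (level y j.*2.+1 `&` level z j.*2.+2 <= less y z)%O.
    exact: level_less.
  rewrite lexI; apply/andP; split; [apply: le_trans xy|apply: le_trans yz].
    by rewrite meetCA leI2 // leIl.
  by rewrite leI2 // leIr.
(* In an index [((u, v), (j, j'))] the smaller [j] goes with [z] and the larger [j'] with [x], the
   order that contradicts [x < z]. *)
pose left (i : (B * B) * (nat * nat)) := (i.1.1 `&` level x i.2.2.*2)%O.
pose right (i : (B * B) * (nat * nat)) := (i.1.2 `&` level z i.2.1.*2.+2)%O.
pose N := iota 0 (size s).+1.
pose l := [seq i <- [seq (p, jj) | p <- s,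
    jj <- [seq (j, j') | j <- N, j' <- N]] | i.2.1 < i.2.2].
have [|t [Tt t0 tP]] := deciding_element (a := left) (b := right) (s := l)
    (span_subalgebra S (U `&` V)) nontriv.
  move=> [[u v] [j j']]; rewrite mem_filter => /andP[jj'].
  move=> /allpairsP[[p jj] /= [+ _ [pE _]]]; rewrite -pE => {p pE jj} suv.
  have [/= Uu Vv] := sUV _ suv.
  have [_ _ UI _ _] := span_subalgebra S U.
  have [_ _ VI _ VC] := span_subalgebra S V.
  apply: (interp U V) => //.
  - by apply: UI => //; apply: span_setI.
  - by apply: VC; apply: VI => //; apply: span_setI.
  - rewrite -disj_leC meetACA -lex0 -(meetxC (less x z)) leI2 //.
      by apply: le_trans rl; rewrite rE (joins_sup_seq _ suv).
    by apply: level_not_less; rewrite -doubleS leq_double.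
(* As [t] lies over [U & V], the level of [x] meets it by genericity over [Hyz]; the result lies
   over [Hxy], so the level of [z] meets it in turn. This nonzero meet is below [r], hence touches
   some rectangle. *)
have hit j : exists p, j \in N -> [/\ p \in s,
    (t `&` (p.1 `&` level x j.*2))%O <> \bot%O &
    (t `&` (p.2 `&` level z j.*2.+2))%O <> \bot%O].
  have w0 : (level z j.*2.+2 `&` (level x j.*2 `&` t))%O <> \bot%O.
    apply: gz; last by apply: gx => //; apply: spanS Tt => i [_ []].
    by apply: xyI => //; apply: spanS Tt => i [[]].
  have [|p sp wp] :=
    meet_joins_neq0 (s := s) (F := fun p => (p.1 `&` p.2)%O) _ w0.
    rewrite -rE; apply: le_trans (rect j).
    by rewrite lexI; apply/andP; split; meet_le.
  exists p => _; split=> //; apply: le_neq0 wp.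
    by rewrite !lexI; do ![apply/andP; split]; meet_le.
  by rewrite !lexI; do ![apply/andP; split]; meet_le.
have [g gP] := choice hit.
have inj j j' : j \in N -> j' \in N -> j < j' -> g j <> g j'.
  move=> Nj Nj' jj' e.
  have [sj _ nb] := gP j Nj; have [_ na _] := gP j' Nj'.
  have [|tl|tr] := tP (g j, (j, j')).
  - rewrite mem_filter; apply/andP; split; first exact: jj'.
    by apply: allpairs_f => //; apply: allpairs_f.
  - by apply: na; rewrite -e.
  - exact: nb.
have : uniq (map g N).
  rewrite map_inj_in_uniq ?iota_uniq // => j j' Nj Nj' e.
  by case: (ltngtP j j') => // [/(inj _ _ Nj Nj')|/(inj _ _ Nj' Nj)/nesym].
move=> /uniq_leq_size sub; have /sub : {subset map g N <= s}.
  by move=> _ /mapP[j Nj ->]; case: (gP j Nj).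
by rewrite size_map size_iota ltnn.
Qed.


End Levels.

(** * Subalgebras as Boolean algebras, and the diagonal extension *)

Section SubalgebraType.
Variables (d : Order.disp_t) (B : ctbDistrLatticeType d) (A : set B).
Hypothesis subA : subalgebra A.

(** The beta-redex makes [subA] a parameter of the type, so that the instances declared on it can
    use the closure properties. *)
Definition subalgebra_type : Type :=
  (fun _ : subalgebra A => {x | x \in A}) subA.
Local Notation T := subalgebra_type.

HB.instance Definition _ := Choice.on T.

Let elt (x : B) (Ax : A x) : T := exist _ x (mem_set Ax).

Let memA (u : T) : A (val u). Proof. exact: set_mem (valP u). Qed.

Let closed_meet (u v : T) : A (val u `&` val v)%O.
Proof. by case: subA => _ _ + _ _; apply; apply: memA. Qed.
Let closed_join (u v : T) : A (val u `|` val v)%O.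
Proof. by case: subA => _ _ _ + _; apply; apply: memA. Qed.
Let closed_compl (u : T) : A (~` val u)%O.
Proof. by case: subA => _ _ _ _; apply; apply: memA. Qed.
Let botA : A \bot%O. Proof. by case: subA. Qed.
Let topA : A \top%O. Proof. by case: subA. Qed.

Definition subalg_meet (u v : T) : T := elt (closed_meet u v).
Definition subalg_join (u v : T) : T := elt (closed_join u v).
Definition subalg_compl (u : T) : T := elt (closed_compl u).
Definition subalg_le (u v : T) : bool := subalg_meet u v == u.
Definition subalg_lt (u v : T) : bool := (v != u) && subalg_le u v.

Let subalg_meetC : commutative subalg_meet.
Proof. by move=> u v; apply: val_inj; rewrite /= meetC. Qed.
Let subalg_joinC : commutative subalg_join.
Proof. by move=> u v; apply: val_inj; rewrite /= joinC. Qed.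
Let subalg_meetA : associative subalg_meet.
Proof. by move=> u v w; apply: val_inj; rewrite /= meetA. Qed.
Let subalg_joinA : associative subalg_join.
Proof. by move=> u v w; apply: val_inj; rewrite /= joinA. Qed.
Let subalg_joinKI (v u : T) : subalg_meet u (subalg_join u v) = u.
Proof. by apply: val_inj; rewrite /= joinKI. Qed.
Let subalg_meetKU (v u : T) : subalg_join u (subalg_meet u v) = u.
Proof. by apply: val_inj; rewrite /= meetKU. Qed.
Let subalg_meetUl : left_distributive subalg_meet subalg_join.
Proof. by move=> u v w; apply: val_inj; rewrite /= meetUl. Qed.
Let subalg_meetxx : idempotent_op subalg_meet.
Proof. by move=> u; apply: val_inj; rewrite /= meetxx. Qed.

HB.instance Definition _ :=
  Order.isMeetJoinDistrLattice.Build (Order.Disp tt tt) T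
    (fun _ _ => erefl : subalg_le _ _ = _) (fun _ _ => erefl : subalg_lt _ _ = _)
    subalg_meetC subalg_joinC subalg_meetA subalg_joinA subalg_joinKI
    subalg_meetKU subalg_meetUl subalg_meetxx.

Let le0 (u : T) : (elt botA <= u)%O.
Proof. by apply/eqP/val_inj; rewrite /= meet0x. Qed.
Let le1 (u : T) : (u <= elt topA)%O.
Proof. by apply/eqP/val_inj; rewrite /= meetx1. Qed.

HB.instance Definition _ := Order.hasBottom.Build (Order.Disp tt tt) T le0.
HB.instance Definition _ := Order.hasTop.Build (Order.Disp tt tt) T le1.

Let subalg_joinxC (u : T) : (u `|` subalg_compl u)%O = \top%O.
Proof. by apply: val_inj; rewrite /= joinxC. Qed.
Let subalg_meetxC (u : T) : (u `&` subalg_compl u)%O = \bot%O.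
Proof. by apply: val_inj; rewrite /= meetxC. Qed.

HB.instance Definition _ :=
  Order.TBDistrLattice_hasComplement.Build (Order.Disp tt tt) T
    subalg_joinxC subalg_meetxC.

Definition subalgebra_val (u : T) : B := val u.

Lemma subalgebra_val_embedding : boolean_embedding subalgebra_val.
Proof. by split; [split|apply: val_inj]. Qed.

End SubalgebraType.

(** The constant pairs serve as countable subalgebra: [(x, y)] is
    [(x, x) & (1, 0) | (y, y) & (0, 1)], and a diagonal element below [(s, s')] is interpolated by
    the diagonal image of the meet of [s] and [s']. *)
Lemma diagonal_posex (d : Order.disp_t) (A : ctbDistrLatticeType d) :
  posex_embedding (fun x : A => (x, x) : A *p A).
Proof.
set v := fun x : A => _; split; first by split=> [|x y []].
pose two : set A := [set \bot%O; \top%O].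
have [S0 S1 SI SU SC] : subalgebra two by apply: subalgebra_two.
exists (two `*` two); split.
  have c2 : countable two.
    exact/finite_set_countable/finite_set2.
  exact: countableX.
split.
- split=> [||[x x'] [y y'] [/= ? ?] [/= ? ?]
           |[x x'] [y y'] [/= ? ?] [/= ? ?]|[x x'] [/= ? ?]].
  + by split.
  + by split.
  + by split; apply: SI.
  + by split; apply: SU.
  + by split; apply: SC.
- split=> [||_ _ [x _ <-] [y _ <-]|_ _ [x _ <-] [y _ <-]|_ [x _ <-]].
  + by exists \bot%O.
  + by exists \top%O.
  + by exists (x `&` y)%O.
  + by exists (x `|` y)%O.
  + by exists (~` x)%O.
- apply/esym/seteqP; split=> // -[x y] _.
  set G := generated _.
  have [_ _ GI GU _] : subalgebra G by apply: generated_subalgebra.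
  pose P (a b : A) : A *p A := (a, b).
  have -> : (x, y) = (P x x `&` P \top \bot `|` P y y `&` P \bot \top)%O.
    rewrite joinEprod !meetEprod /=.
    by rewrite !meetx0 !meetx1 joinx0 join0x.
  by apply: GU; apply: GI; apply: sub_gen_smallest;
    (by right; eexists) || by left; split.
- move=> _ [s s'] [x _ <-] [/= Ss Ss']; rewrite leEprod => /andP[/= xs xs'].
  exists (v (s `&` s')%O); split.
  + by split; [exists (s `&` s')%O|split; apply: SI].
  + by rewrite leEprod /= lexI xs xs'.
  + by rewrite leEprod /= leIl leIr.
Qed.

(** * Generic functions from the extension property *)

(** The single operation [nand] yields all the others, so closing [H] and the constants under it in
    countably many steps gives a subalgebra. *)
Lemma generated_small (K : Type) (d : Order.disp_t)
    (B : ctbDistrLatticeType d) (H : set B) :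
  square_absorbing K -> H #<= [set: K] -> generated H #<= [set: K].
Proof.
move=> sqK sH; pose nand x y : B := (~` (x `&` y))%O.
pose next X := X `|` [set z | exists x y, [/\ X x, X y & z = nand x y]].
pose X n := iter n next (H `|` [set \bot%O; \top%O]).
have small n : X n #<= [set: K].
  elim: n => [|n IH]; apply: setU_small => //.
    apply: countable_small => //; exact/finite_set_countable/finite_set2.
  exact: image2_small.
have mono n m : X n `<=` X (m + n).
  by elim: m => // m IH x /IH; left.
have Xnand x y : (\bigcup_n X n) x -> (\bigcup_n X n) y ->
    (\bigcup_n X n) (nand x y).
  move=> [n _ nx] [m _ my]; exists (m + n).+1 => //; right; exists x, y.
  by split=> //; [apply: mono|rewrite addnC; apply: mono].
have XC x : (\bigcup_n X n) x -> (\bigcup_n X n) (~` x)%O.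
  by move=> Xx; have := Xnand x x Xx Xx; rewrite /nand meetxx.
apply: (@card_le_trans _ _ _ (\bigcup_n X n)); last first.
  by apply: bigcup_small => //; case: sqK.
apply: subset_card_le; apply: generated_min; last first.
  by move=> x Hx; exists 0 => //; left.
split.
- by exists 0 => //; right; left.
- by exists 0 => //; right; right.
- by move=> x y Xx Xy; have := XC _ (Xnand x y Xx Xy); rewrite /nand complK.
- move=> x y Xx Xy; have := Xnand _ _ (XC x Xx) (XC y Xy).
  by rewrite /nand complI !complK.
- exact: XC.
Qed.

Definition posex_injective (d : Order.disp_t) (BB : ctbDistrLatticeType d)
    (C : Type) : Prop :=
  forall (dA dB : Order.disp_t)
    (A : ctbDistrLatticeType dA) (B : ctbDistrLatticeType dB)
    (u : A -> BB) (v : A -> B),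
    card_lt [set: A] [set: C] ->
    boolean_embedding u -> posex_embedding v ->
    exists2 u' : B -> BB, boolean_embedding u' & u' \o v = u.

(* Extend the inclusion of [A] along the diagonal [A -> A * A] and take the
   image of [(1, 0)]. *)
Lemma splitting_element (d : Order.disp_t) (BB : ctbDistrLatticeType d)
    (C : Type) (A : set BB) :
    posex_injective BB C -> subalgebra A -> card_lt A [set: C] ->
  exists e, forall w, A w -> w <> \bot%O ->
    (e `&` w)%O <> \bot%O /\ (~` e `&` w)%O <> \bot%O.
Proof.
move=> ext subA smallA.
have smallT : card_lt [set: subalgebra_type subA] [set: C].
  apply/card_ltNge => CT; move/card_ltNge: smallA; apply.
  by rewrite -(card_le_eqr (card_setT A)).
have [u' [[u0 u1 uI uU uC] inj] ext_u] := ext _ _ _ _ _ _ smallT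
  (subalgebra_val_embedding subA) (diagonal_posex _).
set T := subalgebra_type subA in smallT u' u0 u1 uI uU uC inj ext_u.
pose P (a b : T) : T *p T := (a, b).
exists (u' (P \top \bot)%O) => w Aw w0.
pose w' : T := exist _ w (mem_set Aw).
have wE : w = u' (P w' w').
  by have /= -> := congr1 (fun h : T -> BB => h w') ext_u.
have w'0 : w' <> \bot%O by move=> /(congr1 val).
split=> uw0; apply: w'0.
  have /inj : u' (P w' \bot)%O = u' \bot%O.
    by rewrite u0 -uw0 wE -uI /P meetEprod /= meet1x meet0x.
  by case.
have /inj : u' (P \bot w')%O = u' \bot%O.
  rewrite u0 -uw0 wE -uC -uI /P complEprod meetEprod /=.
  by rewrite compl1 compl0 meet1x meet0x.
by case.
Qed.

(** Choose successively [e (An n)] splitting every nonzero element of the subalgebra generated by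
    [A] and the earlier choices, represent it by [X n], and let [x k] be the first [n] with [k] in
    [X n]. Then [[x = n]] lies above [e (An n)] minus the earlier choices, which meets every nonzero
    element of [A]. *)
Lemma exists_generic (d : Order.disp_t) (BB : ctbDistrLatticeType d)
    (q : set nat -> BB) (K : Type) (A : set BB) :
    q setT = \top%O -> (forall X Y, q (X `&` Y) = (q X `&` q Y)%O) ->
    (forall X, q (~` X) = (~` q X)%O) -> (forall b, exists X, q X = b) ->
    posex_injective BB (set nat) -> square_absorbing K ->
    ~ ([set: set nat] #<= [set: K]) ->
    subalgebra A -> A #<= [set: K] ->
  exists x, generic q A x.
Proof.
move=> qT qI qC qsurj ext sqK ltK subA smallA.
have [A'|e eP] := @choice (set BB) BB (fun A' e => subalgebra A' ->
    A' #<= [set: K] -> forall w, A' w -> w <> \bot%O ->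
    (e `&` w)%O <> \bot%O /\ (~` e `&` w)%O <> \bot%O).
  have [[subA' smallA']|no] := pselect (subalgebra A' /\ A' #<= [set: K]).
    have [||e eP] := splitting_element (A := A') ext => //; last by exists e.
    by apply/card_ltNge => nA'; apply: ltK; apply: card_le_trans nA' smallA'.
  by exists \bot%O => subA' smallA'; case: no.
pose An n := iter n (fun A' => generated (A' `|` [set e A'])) A.
have [X XE] := choice (fun n => qsurj (e (An n))).
have AnP n : subalgebra (An n) /\ An n #<= [set: K].
  elim: n => //= n [_ IH]; split; first exact: generated_subalgebra.
  apply: generated_small => //; apply: setU_small => //.
  by apply: countable_small => //; apply: countable1.
have An_e n : An n.+1 (e (An n)) by apply: sub_gen_smallest; right.
have An_sub n : An n `<=` An n.+1 by move=> w nw; apply: sub_gen_smallest; left.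
pose rest n := \bigcap_(m in `I_n) ~` X m.
have restS n : rest n.+1 = rest n `&` ~` X n.
  apply/seteqP; split=> [k r|k [rk Xk] m /=].
    by split=> [m /= mn|]; apply: r => //=; apply: ltnW.
  by rewrite ltnS leq_eqVlt => /orP[/eqP->//|]; apply: rk.
have rest0 : rest 0 = setT by rewrite /rest II0 bigcap_set0.
have disj n m k : n < m -> X n k -> ~ rest m k by move=> nm Xnk /(_ n nm).
(* Points in no [X n] get the value 0, so level 0 may exceed [X 0]; what counts is the inclusion of
   [rest n & X n] in level [n]. *)
have [k|x xP] := @choice nat nat
    (fun k n => forall m, (rest m `&` X m) k -> n = m).
  have [[n [rn Xn]]|no] := pselect (exists n, (rest n `&` X n) k).
    exists n => m [rm Xm]; case: (ltngtP n m) => // [nm|mn].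
      by case: (disj n m k nm Xn).
    by case: (disj m n k mn Xm).
  by exists 0 => m mk; case: no; exists m.
exists x => n w Aw w0.
have restP m : An m (q (rest m) `&` w)%O /\ (q (rest m) `&` w)%O <> \bot%O.
  elim: m => [|m [IHA IH0]]; first by rewrite rest0 qT meet1x.
  rewrite restS qI qC XE [(q _ `&` _)%O]meetC -meetA; split.
    have [_ _ AI _ AC] := (AnP m.+1).1.
    by apply: AI; [apply: AC; apply: An_e|apply: An_sub].
  by have [] := eP _ (AnP m).1 (AnP m).2 _ IHA IH0.
have [nA n0] := restP n; have [+ _] := eP _ (AnP n).1 (AnP n).2 _ nA n0.
apply: le_neq0; rewrite -XE meetA -qI leI2 //; apply: q_mono => //.
by move=> k [Xk rk]; apply: xP.
Qed.

(** * Counting supports when the continuum is large *)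

Section LargeContinuum.
Variables (d : Order.disp_t) (BB : ctbDistrLatticeType d) (q : set nat -> BB).
Hypothesis q0 : q set0 = \bot%O.
Hypothesis qT : q setT = \top%O.
Hypothesis qI : forall X Y, q (X `&` Y) = (q X `&` q Y)%O.
Hypothesis qC : forall X, q (~` X) = (~` q X)%O.
Hypothesis q_surj : forall b, exists X, q X = b.
Hypothesis nontriv : \top%O <> \bot%O :> BB.
Hypothesis filtered : tightly_sigma_filtered BB.
Hypothesis ext : posex_injective BB (set nat).

(** A continuum not bounded by |K2| leaves room for generic functions over spans of at most |K2|
    indices. The terms of the sequence [f] bring disjoint new supports, so a set of fewer indices
    misses one of them. *)
Lemma continuum_le_successor (K1 K2 : Type) (R1 : K1 -> K1 -> Prop)
    (R2 : K2 -> K2 -> Prop) :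
  succ_wo nat R1 -> succ_wo K1 R2 -> [set: set nat] #<= [set: K2].
Proof.
move=> succ1 succ2; apply: contrapT => ltK2.
have sq1 := succ_wo_square square_absorbing_nat succ1.
have sq2 := succ_wo_square sq1 succ2.
have [_ _ nK1] := succ1; have [[wf2 tr2 tot2] seg2 nK2] := succ2.
have K12 : [set: K1] #<= [set: K2].
  by have [//|K21] := card_le_total [set: K1] [set: K2]; case: nK2.
have [I [R [S skel]]] := filtered_skeleton filtered.
pose seg i := initial_segment R i.
have countable_support P H : countable P -> P `<=` span S H ->
    exists C, [/\ countable C, C `<=` H & P `<=` span S C].
  move=> cP PH; have [x|F FP] := @choice BB (set I) (fun x C => P x ->
      [/\ countable C, C `<=` H & span S C x]).
    have [/PH/span_countable_support[C CP]|nPx] := pselect (P x).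
      by exists C.
    by exists set0.
  exists (\bigcup_(x in P) F x); split.
  - by apply: bigcup_countable => // x /FP[].
  - by apply: bigcup_sub => x /FP[].
  - move=> x Px; have [_ _ Fx] := FP x Px; apply: spanS Fx.
    exact: bigcup_sup.
have [i|E EP] := @choice I (set I) (fun i C => [/\ countable C, C `<=` seg i &
    S i `&` span S (seg i) `<=` span S C]).
  apply: countable_support; last by move=> x [].
  apply: sub_countable (skel_countable skel i).
  by apply: subset_card_le => x [].
have E_countable i : countable (E i) by case: (EP i).
have E_before i : E i `<=` seg i by case: (EP i).
have E_support i x : span S (seg i) x -> S i x -> span S (E i) x.
  by move=> ix Six; case: (EP i) => _ _; apply.
have closure P : countable P ->
    exists H, [/\ countable H, closed_support E H & P `<=` span S H].
  move=> cP; have [|C [cC _ PC]] := countable_support P setT cP.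
    by move=> x _; apply: skel_full skel x.
  have [H [cH clH CH]] := countable_closed_support E_countable cC.
  by exists H; split=> // x /PC; apply: spanS.
have [x|G GP] := @choice (nat -> nat) (set I) (fun x H => [/\ countable H,
    closed_support E H & forall n, span S H (level q x n)]).
  have [|H [cH clH xH]] := closure (range (level q x)).
    exact: card_le_trans (card_image_le _ _) _.
  by exists H; split=> // n; apply: xH; exists n.
have [[x y]|J JP] := @choice ((nat -> nat) * (nat -> nat)) (set I)
    (fun p H => [/\ countable H, closed_support E H, span S H (less q p.1 p.2),
      forall n, span S H (level q p.1 n) & forall n, span S H (level q p.2 n)]).
  have [|H [cH clH xyH]] := closure (less q x y |`
      (range (level q x) `|` range (level q y))).
    apply: (setU_small square_absorbing_nat); first exact: countable1.
    by apply: (setU_small square_absorbing_nat); apply: card_image_le.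
  exists H; split=> //= [|n|n]; apply: xyH.
  - by left.
  - by right; left; exists n.
  - by right; right; exists n.
(* If [w] over [L] misses [[x = n]], some [r] over [G x & L], hence over [K], lies between [[x = n]]
   and the complement of [w]. Genericity over [K] forces [r] to be [\top], so [w] is [\bot]. *)
have transfer K L x : closed_support E K -> closed_support E L ->
    generic q (span S K) x -> G x `&` L `<=` K -> generic q (span S L) x.
  move=> clK clL gx GLK n w Lw w0 xw0; have [_ clG Gx] := GP x.
  have [_ _ _ _ LC] := span_subalgebra S L.
  have [_ _ _ _ KC] := span_subalgebra S K.
  have xw : (level q x n <= ~` w)%O by rewrite -disj_leC xw0.
  have [r [GLr xr rw]] := span_interpolation skel E_before E_support
    clG clL (Gx n) (LC _ Lw) xw.
  have r1 : (~` r)%O = \bot%O.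
    apply: contrapT => r0; apply: (gx n _ _ r0).
      by apply: KC; apply: spanS GLr.
    by apply/eqP; rewrite disj_leC complK.
  by apply: w0; apply/eqP; rewrite -lex0 -r1 lexC.
have span_small H : H #<= [set: K2] -> span S H #<= [set: K2].
  move=> sH; apply: generated_small => //; apply: bigcup_small => // i _.
  by apply: countable_small => //; apply: skel_countable skel i.
pose past (A : set (nat -> nat)) := \bigcup_(y in A) G y.
have gen_ex H : H #<= [set: K2] -> exists x, generic q (span S H) x.
  move=> sH; apply: (exists_generic (K := K2)) => //.
    exact: span_subalgebra.
  exact: span_small.
have [w A Aw|f fP] := @transfinite_choice K2 R2 (nat -> nat)
    (fun _ A x => generic q (span S (past A)) x) wf2.
  apply: gen_ex; apply: bigcup_small => // [|y _].
    exact: card_le_trans Aw (card_le_trans (seg2 w) K12).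
  by apply: countable_small => //; case: (GP y).
pose K w := past (f @` initial_segment R2 w).
(* The part of the support of [f w] that no earlier term has. *)
pose D w := G (f w) `\` K w.
have clG x : closed_support E (G x) by case: (GP x).
have clK w : closed_support E (K w).
  by apply: closed_support_bigcup => y _; apply: clG.
have clJ p : closed_support E (J p) by case: (JP p).
have D_inj v w i : D v i -> D w i -> v = w.
  have excl v' w' : R2 v' w' -> D v' i -> D w' i -> False.
    by move=> vw [Gi _] [_]; apply; exists (f v') => //; exists v'.
  by move=> vi wi; case: (tot2 v w) => // [/excl/(_ vi wi)|/excl/(_ wi vi)].
have avoid w H : D w `&` H = set0 -> closed_support E H ->
    generic q (span S H) (f w).
  move=> DH clH; apply: (transfer (K w)) => // [|i [Gi Hi]]; first exact: fP.
  apply: contrapT => nKi.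
  have : (D w `&` H) i by split=> //; split.
  by rewrite DH.
(* By disjointness, the terms whose [D w] meets [H] inject into [H]. *)
have many (A : set K2) (H : set I) : ~ (A #<= H) ->
    exists2 w, A w & D w `&` H = set0.
  move=> nAH; apply: contrapT => no; apply: nAH.
  apply: (card_le_rel (r := fun w i => D w i)) => [w Aw|v w i _ _ _].
    have /eqP/set0P[i [Di Hi]] : D w `&` H <> set0.
      by move=> e; apply: no; exists w.
    by exists i.
  exact: D_inj.
have [z gz] : exists z, generic q
    (span S (\bigcup_(p in [set: K2 * K2]) J (f p.1, f p.2))) z.
  apply: gen_ex; apply: bigcup_small => // [|p _]; first by case: sq2.
  by apply: countable_small => //; case: (JP (f p.1, f p.2)).
(* [A] has size aleph_1: small enough that some [w] avoids all [J (f v, z)] with [v] in [A], and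
   large enough that some [v] in [A] avoids the countable [J (f w, z)]. *)
have /card_subP[A AK1 _] := K12.
have /card_eqPle[AK1l AK1r] := AK1.
pose U := \bigcup_(v in A) J (f v, z).
have sU : U #<= [set: K1].
  apply: bigcup_small => // v _; apply: countable_small => //.
  by case: (JP (f v, z)).
have [|w _ DwU] := many setT U.
  by move=> le; apply: nK2; apply: card_le_trans le sU.
have [|v Av DvJ] := many A (J (f w, z)).
  move=> le; apply: nK1; apply: card_le_trans AK1r (card_le_trans le _).
  by case: (JP (f w, z)).
have [_ _ lvw vwv _] := JP (f v, f w).
have [_ _ lwz _ wzz] := JP (f w, z).
have [_ _ lvz vzv vzz] := JP (f v, z).
apply: (@no_free_triple _ _ q q0 qI nontriv _ _ _ skel _ E_before E_support
  (f v) (f w) z (J (f v, f w)) (J (f w, z)) (J (f v, z))) => //.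
- exact: avoid.
- by apply: avoid => //; rewrite -subset0 -DwU; apply: setIS => i Ji; exists v.
- move=> n b bJ; apply: gz; apply: spanS bJ => i Ji.
  by exists (v, w).
Qed.

End LargeContinuum.

(** * Transfer from [Pomega_fin] and conclusion *)

(** The inverse isomorphism after the quotient map lets sets of naturals represent elements of [BB]
    directly. *)
Lemma iso_quotient_map (d : Order.disp_t) (BB : ctbDistrLatticeType d) :
    boolean_isomorphic BB Pomega_fin ->
  exists q : set nat -> BB,
    [/\ q set0 = \bot%O, q setT = \top%O,
        forall X Y, q (X `&` Y) = (q X `&` q Y)%O,
        forall X, q (~` X) = (~` q X)%O & forall b, exists X, q X = b].
Proof.
move=> [f [[f0 f1 fI _ fC] [g fK gK]]].
exists (fun X => g (\pi_Pomega_fin X)%qT); split.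
- by apply: (can_inj fK); rewrite gK f0.
- by apply: (can_inj fK); rewrite gK f1.
- by move=> X Y; apply: (can_inj fK); rewrite fI !gK -pf_meetE.
- by move=> X; apply: (can_inj fK); rewrite fC !gK -pf_complE.
- by move=> b; exists (repr (f b)); rewrite reprK fK.
Qed.

Lemma Pomega_fin_nontrivial : \top%O <> \bot%O :> Pomega_fin.
Proof.
move=> /pifinP/eqfinP[+ _]; rewrite setD0; exact: infinite_nat.
Qed.

Theorem theorem11
    (cont_regular : regular_cardinal (set nat))
    (d : Order.disp_t) (BB : ctbDistrLatticeType d)
    (BB_card : [set: BB] #= [set: set nat])
    (BB_filtered : tightly_sigma_filtered BB)
    (BB_extension :
      forall (dA dB : Order.disp_t)
        (A : ctbDistrLatticeType dA) (B : ctbDistrLatticeType dB)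
        (u : A -> BB) (v : A -> B),
        card_lt [set: A] [set: set nat] ->
        boolean_embedding u -> posex_embedding v ->
        exists2 u' : B -> BB, boolean_embedding u' & u' \o v = u)
    (BB_iso : boolean_isomorphic BB Pomega_fin) :
  exists2 K : Type, is_aleph 2 K & [set: set nat] #<= [set: K].
Proof.
have [K1 [R1 succ1]] := exists_succ_wo nat.
have [K2 [R2 succ2]] := exists_succ_wo K1.
exists K2.
  exists K1; last exact: succ_wo_successor succ2.
  by exists nat; [apply: card_eqxx|apply: succ_wo_successor succ1].
have [q [q0 qT qI qC qsurj]] := iso_quotient_map BB_iso.
apply: (continuum_le_successor q0 qT qI qC qsurj _ BB_filtered BB_extension
  succ1 succ2).
have [f [[f0 f1 _ _ _] _]] := BB_iso.
by move=> e; apply: Pomega_fin_nontrivial; rewrite -f0 -f1 e.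
Qed.
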